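(* Let $p\ge 2$ be an integer, let $f\in\mathcal{A}^p$, $f(z)=\sum_{\|n\|=0}^{+\infty}a_nz^n$, let $Z=(Z_n(t))_{n\in\mathbb{Z}_+^p}$, $Z_n(t)=X_n(t)+iY_n(t)$, be a complex multiplicative system uniformly bounded by the number $1$, and let $\delta>0$. Put $$f(z,t)=\sum_{\|n\|=0}^{+\infty}a_nZ_n(t)z_1^{n_1}\cdots z_p^{n_p},\qquad M_f(r,t)=\max\{|f(z,t)|\colon |z_j|\le r_j,\ j\in\{1,\ldots,p\}\}.$$ Then for almost every $t\in[0,1]$ (with respect to Lebesgue measure) there exists a set $E=E(f,t,\delta)\subset[0,1)^p$ with $E\in\Upsilon$ such that for all $r\in[0,1)^p\setminus E$ $$M_f(r,t)\leq \mu_f(r)\Biggl(\prod_{j=1}^p\frac{1}{\sqrt{1-r_j}}\cdot\ln^{p/4}\Biggl\{\mu_f(r)\prod_{j=1}^p\frac{1}{1-r_j}\Biggr\}\Biggr)^{1+\delta}.$$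
   Context: Notation: $\mathbb{D}^p=\{z\in\mathbb{C}^p\colon |z_j|<1,\ j\in\{1,\ldots,p\}\}$; for $n=(n_1,\ldots,n_p)\in\mathbb{Z}_+^p$ (nonnegative integer multi-indices), $\|n\|=n_1+\cdots+n_p$, $z^n=z_1^{n_1}\cdots z_p^{n_p}$, $r^n=r_1^{n_1}\cdots r_p^{n_p}$. $\ln^{a}x$ means $(\ln x)^a$. $\mathcal{A}^p$ is the class of analytic functions represented by power series $f(z)=\sum_{\|n\|=0}^{+\infty}a_nz^n$ (with $a_n\in\mathbb{C}$) whose domain of convergence is $\mathbb{D}^p$. Maximal term: for $r=(r_1,\ldots,r_p)\in[0,1)^p$, $\mu_f(r)=\max\{|a_n|r^n\colon n\in\mathbb{Z}_+^p\}$, where $a_n$ are the coefficients of the (deterministic) function $f$. Exceptional sets: for $r_0\in[0,1)^p$ let $\triangle_{r_0}=\{t\in[0,1)^p\colon t_j\ge (r_0)_j,\ j\in\{1,\ldots,p\}\}$. A (Lebesgue measurable) set $E\subset[0,1)^p$ is of asymptotically finite logarithmic measure, written $E\in\Upsilon$, if there exists $r_0\in[0,1)^p$ such that $$\int\cdots\int_{E\cap\triangle_{r_0}}\prod_{i=1}^p\frac{dr_i}{1-r_i}<+\infty.$$ Probability: random variables are defined on $\Omega=[0,1]$ with the $\sigma$-algebra of Lebesgue measurable sets and Lebesgue measure $P$; ${\bf M}\xi$ denotes the expected value. A family $(X_n(t))_{n\in\mathbb{Z}_+^p}$ of real random variables is a multiplicative system (MS) if ${\bf M}(X_{i_1}X_{i_2}\cdots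 X_{i_k})=0$ for every $k\ge1$ and all pairwise distinct indices $i_1,\ldots,i_k$. A complex sequence $Z_n=X_n+iY_n$ is called a (complex) multiplicative system if both $(X_n)$ and $(Y_n)$ are real multiplicative systems; it is uniformly bounded by the number $1$ if $|Z_n(t)|\le 1$ for almost all $t\in[0,1]$ and all $n$. *)

(* Defs.v *)
(* Conventions: multi-indices are {ffun 'I_p -> nat}; points of C^p are row
   vectors 'rV[R[i]^o]_p (the ^o selects the norm topology on R[i]); points of
   R^p are p.-tuples, the carrier of the library's product sigma-algebra. *)
From HB Require Import structures.
From mathcomp Require Import all_boot all_order all_algebra.
From mathcomp Require Import all_classical all_reals all_analysis.
From mathcomp Require Import complex.

Set Implicit Arguments.
Unset Strict Implicit.
Unset Printing Implicit Defensive.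

Import Order.TTheory GRing.Theory Num.Theory.
Import numFieldNormedType.Exports.

Local Open Scope classical_set_scope.
Local Open Scope ring_scope.
Local Open Scope complex_scope.

Notation normc := ComplexField.Normc.normc.
Notation multi_index p := {ffun 'I_p -> nat}.
Notation Rtuple R p := (p.-tuple (measurableTypeR R)).

Section LebesgueTuple.
Context {R : realType}.

Definition cons_pair (p : nat) (x : measurableTypeR R * Rtuple R p) :
  Rtuple R p.+1 := [tuple of x.1 :: x.2].

Lemma measurable_cons_pair (p : nat) :
  measurable_fun [set: measurableTypeR R * Rtuple R p] (@cons_pair p).
Proof. exact: measurable_cons. Qed.

Section Step.
Variables (p : nat) (m : {sigma_finite_measure set (Rtuple R p) -> \bar R}).

Definition lebesgue_cons : set (Rtuple R p.+1) -> \bar R :=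
  pushforward (@lebesgue_measure R \x m)%E (@cons_pair p).

Let lebesgue_cons0 : lebesgue_cons set0 = 0%E.
Proof. by rewrite /lebesgue_cons /pushforward preimage_set0 measure0. Qed.

Let lebesgue_cons_ge0 A : (0 <= lebesgue_cons A)%E.
Proof. exact: (measure_ge0 (lebesgue_measure \x m)%E). Qed.

Let lebesgue_cons_sigma_additive : semi_sigma_additive lebesgue_cons.
Proof.
move=> F mF tF mUF; rewrite /lebesgue_cons /pushforward preimage_bigcup.
have mpre A : measurable A -> measurable (@cons_pair p @^-1` A).
  by move=> mA; rewrite -[X in measurable X]setTI; exact: measurable_cons_pair.
apply: measure_semi_sigma_additive.
- by move=> n; exact: mpre.
- apply/trivIsetP => /= i j _ _ ij; rewrite -preimage_setI.
  by move/trivIsetP : tF => /(_ _ _ _ _ ij) ->//; rewrite preimage_set0.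
- by rewrite -preimage_bigcup; exact: mpre.
Qed.

HB.instance Definition _ := isMeasure.Build _ _ _ lebesgue_cons
  lebesgue_cons0 lebesgue_cons_ge0 lebesgue_cons_sigma_additive.

Let lebesgue_cons_sigma_finite : sigma_finite setT lebesgue_cons.
Proof.
have /sigma_finiteP[F [TF ndF Foo]] := sigma_finiteT (@lebesgue_measure R).
have /sigma_finiteP[G [TG ndG Goo]] := sigma_finiteT m.
pose g (u : Rtuple R p.+1) : measurableTypeR R * Rtuple R p :=
  (thead u, [tuple of behead u]).
have mg : measurable_fun setT g.
  apply/measurable_fun_pairP; split; first exact: measurable_tnth.
  exact: measurable_behead.
have cK : cancel (@cons_pair p) g.
  by move=> [x u]; rewrite /g /cons_pair/= theadE; congr pair; exact: val_inj.
exists (fun n => g @^-1` (F n `*` G n)).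
  apply/esym; rewrite -subTset => u _.
  have : setT (g u).1 by [].
  rewrite TF => -[n _ Fn]; have : setT (g u).2 by [].
  rewrite TG => -[k _ Gk]; exists (maxn n k) => //; split.
  - by move: (_.1) Fn; exact/subsetPset/ndF/leq_maxl.
  - by move: (_.2) Gk; exact/subsetPset/ndG/leq_maxr.
move=> n; have [mF Fn] := Foo n; have [mG Gn] := Goo n; split.
  by rewrite -[X in measurable X]setTI; apply: mg => //; exact: measurableX.
have cKF : @cons_pair p @^-1` (g @^-1` (F n `*` G n)) = F n `*` G n.
  by apply/funext => x; exact: (congr1 (F n `*` G n) (cK x)).
rewrite /lebesgue_cons /pushforward cKF product_measure1E//.
by rewrite lte_mul_pinfty// ge0_fin_numE.
Qed.

HB.instance Definition _ := Measure_isSigmaFinite.Build _ _ _ lebesgue_cons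
  lebesgue_cons_sigma_finite.
End Step.

Fixpoint lebesgue_tuple (p : nat) :
    {sigma_finite_measure set (Rtuple R p) -> \bar R} :=
  if p is p'.+1 then lebesgue_cons (lebesgue_tuple p')
  else \d_ ([tuple] : Rtuple R 0).
End LebesgueTuple.

Section LebesgueBox.
Context {R : realType}.

Lemma lebesgue_tuple_box (p : nat) (A : 'I_p -> set (measurableTypeR R)) :
  (forall j, measurable (A j)) ->
  (lebesgue_tuple p [set u | forall j, A j (tnth u j)] =
   \prod_(j < p) lebesgue_measure (A j))%E.
Proof.
elim: p A => [|p IH] A mA.
  by rewrite big_ord0 /= diracE mem_set// => -[].
pose B := [set u : Rtuple R p | forall j, A (lift ord0 j) (tnth u j)].
have mB : measurable B.
  rewrite (_ : B = \bigcap_(j in [set: 'I_p])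
      ((fun u : Rtuple R p => tnth u j) @^-1` A (lift ord0 j))); last first.
    by apply/seteqP; split => [u h j _|u h j]; [exact: h|exact: h j I].
  apply: fin_bigcap_measurable => // j _.
  by rewrite -[X in measurable X]setTI; exact: measurable_tnth.
rewrite big_ord_recl -IH// [LHS]/= /lebesgue_cons /pushforward.
rewrite (_ : _ @^-1` _ = A ord0 `*` B) ?product_measure1E//.
apply/seteqP; split => [[x u] h|[x u] [/= h0 h]].
  by split => [|j]; [exact: (h ord0)|have := h (lift ord0 j); rewrite tnthS].
by move=> j; have [k ->|->] := unliftP ord0 j; rewrite ?tnthS//; exact: h.
Qed.
End LebesgueBox.

Section PowerSeries.
Context {R : realType} (p : nat).
Local Notation C := (R[i]^o).
Implicit Types (n : multi_index p) (a : multi_index p -> C) (z : 'rV[C]_p).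

Definition degree n : nat := (\sum_(j < p) n j)%N.

Definition monomial z n : C := \prod_(j < p) z 0 j ^+ n j.

Definition polydisc : set 'rV[C]_p := [set z | forall j, normc (z 0 j) < 1].

(* Hoermander's convention: the interior of the set of points of absolute
   convergence. *)
Definition domain_of_convergence a : set 'rV[C]_p :=
  interior [set z | (\esum_(n in [set: multi_index p])
                       (normc (a n * monomial z n))%:E < +oo)%E].

(* A function of the class is represented by its coefficient family a. *)
Definition analytic_class a : Prop := domain_of_convergence a = polydisc.

Lemma finite_degree_le (N : nat) :
  finite_set [set n : multi_index p | (degree n <= N)%N].
Proof.
apply: (@sub_finite_set _ _ (range (fun (m : {ffun 'I_p -> 'I_N.+1}) =>
    [ffun j => val (m j)] : multi_index p))); last exact: finite_image.
move=> n nN; exists [ffun j => inord (n j)] => //.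
apply/ffunP => j; rewrite !ffunE /= inordK// ltnS (leq_trans _ nN)//.
by rewrite /degree (bigD1 j)//= leq_addr.
Qed.

(* sum_{||n|| = 0}^{+oo} c_n z^n, summed by increasing total degree; under
   absolute convergence the order is immaterial. *)
Definition multi_series (c : multi_index p -> C) z : C :=
  lim ((fun N : nat => \sum_(n \in [set n | (degree n <= N)%N])
                          c n * monomial z n) @ \oo).

Definition unit_cube : set (Rtuple R p) :=
  [set r | forall j, 0 <= (tnth r j : R) < 1].

(* The supremum is attained when r lies in [0,1)^p and a in the class. *)
Definition max_term a (r : Rtuple R p) : R :=
  sup [set normc (a n) * \prod_(j < p) (tnth r j : R) ^+ n j
       | n in [set: multi_index p]].

(* max { |f(z,t)| : |z_j| <= r_j }, as an extended real so that no finiteness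
   is presupposed. *)
Definition max_modulus (f : 'rV[C]_p -> C) (r : Rtuple R p) : \bar R :=
  ereal_sup [set (normc (f z))%:E
             | z in [set z : 'rV[C]_p | forall j, normc (z 0 j) <= (tnth r j : R)]].

End PowerSeries.

Section LogMeasure.
Context {R : realType} (p : nat).

Definition lebesgue_measurable (E : set (Rtuple R p)) : Prop :=
  ((@lebesgue_tuple R p)^*)%mu.-cara.-measurable E.

Definition complete_lebesgue :=
  @completed_measure_extension _ _ _ (@lebesgue_tuple R p).
HB.instance Definition _ := Measure.on complete_lebesgue.

Definition corner (r0 : Rtuple R p) : set (Rtuple R p) :=
  [set t | unit_cube t /\ forall j, (tnth r0 j : R) <= tnth t j].

Definition asymptotically_finite_log_measure (E : set (Rtuple R p)) : Prop :=
  [/\ E `<=` @unit_cube R p,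
      lebesgue_measurable E &
      exists2 r0, unit_cube r0 &
        (\int[complete_lebesgue]_(r in E `&` corner r0)
            (\prod_(i < p) (1 - (tnth r i : R))^-1)%:E < +oo)%E].

End LogMeasure.

Section MultiplicativeSystem.
Context {R : realType}.

(* R with the sigma-algebra of Lebesgue (not just Borel) measurable sets. *)
Definition lebesgue_line : measurableType _ :=
  caratheodory_type ((wlength (@idfun R))^*)%mu.

Definition unit_interval : set lebesgue_line := [set` `[0%R : R, 1%R]].

Local Notation P := (@completed_lebesgue_measure R).

Definition random_variable01 (X : lebesgue_line -> R) : Prop :=
  measurable_fun unit_interval X.

Definition expectation01 (X : lebesgue_line -> R) : \bar R :=
  (\int[P]_(t in unit_interval) (X t)%:E)%E.

(* An integral equal to 0 carries integrability with it: the library's integral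
   is infinite as soon as the positive or the negative part is. *)
Definition real_MS (I : choiceType) (X : I -> lebesgue_line -> R) : Prop :=
  (forall i, random_variable01 (X i)) /\
  (forall s : seq I, s != [::] -> uniq s ->
     expectation01 (fun t => \prod_(i <- s) X i t) = 0%E).

Definition complex_MS (I : choiceType) (Z : I -> lebesgue_line -> R[i]) : Prop :=
  real_MS (fun i t => complex.Re (Z i t)) /\ real_MS (fun i t => complex.Im (Z i t)).

Definition bounded_by_one (I : choiceType) (Z : I -> lebesgue_line -> R[i]) :
    Prop :=
  {ae P, forall t, unit_interval t -> forall i, normc (Z i t) <= 1}.

End MultiplicativeSystem.

(* Main.v *)
(* Let b_n = |a_n|, G(r) = sum b_n r^n, W(r) = prod_j 1/(1 - r_j) and
   L(r) = ln (mu_f(r) W(r)).  Choose a random multi-index with probability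
   b_n r^n / G(r); its j-th component has mean m_j = r_j d(ln G)/dr_j and variance
   v_j = r_j d(m_j)/dr_j.  Since the integral of u'/u^(1+d) over any interval on which
   u >= 1 is at most 1/d, outside a set of finite logarithmic measure
   m_j <= W^d (ln G)^(1+d)/(1 - r_j) and v_j <= W^d (1 + m_j)^(1+d)/(1 - r_j), where W^d
   compensates for the other coordinates.  By Chebyshev, half of G(r) is carried by
   O(prod_j sqrt v_j) terms, each at most mu_f(r); hence
   G <= C mu_f (W L^(p/2))^(1+3pd), and sum |a_n|^2 r^(2n) <= mu_f G.

   For a multiplicative system bounded by 1, E exp(sum c_n X_n) <= e as soon as
   sum c_n^2 <= 1/4.  Summing this over a grid of polynomial size in the polydisc and
   over the truncation degree N shows that almost surely, for all N and all grid points
   w, the partial sum of degree N at w is O(ln N) times its L^2 norm.  With N a power of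
   W L^(p/2), the tail of the series and the discretization error are both at most
   mu_f, and ln N is absorbed by the exponent delta, as are the constants once r is
   close enough to the distinguished vertex (1, ..., 1). *)
Require Import Defs.
From HB Require Import structures.
From mathcomp Require Import all_boot all_order all_algebra.
From mathcomp Require Import finmap.
From mathcomp Require Import all_classical all_reals all_analysis.
From mathcomp Require Import complex measurable_realfun.
From mathcomp Require Import ring lra zify.

Set Implicit Arguments.
Unset Strict Implicit.
Unset Printing Implicit Defensive.

Import Order.TTheory GRing.Theory Num.Theory.
Import numFieldNormedType.Exports.

Local Open Scope classical_set_scope.
Local Open Scope ring_scope.
Local Open Scope complex_scope.

(** * Fibrewise integrals *)

(** The series may diverge at r_j = 1, so the fundamental theorem of calculus is applied on [rho, 1]
    to partial sums, which are polynomials in r_j. The bound 1/d does not depend on their degree,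
    and Fatou's lemma carries it to the limit. The bound for v_j contains ln G, so the estimate of G
    is implicit: it bounds G by a power of ln G, and ln ln G must be absorbed before ln G can be
    replaced by L. The p standard deviations, each about (ln G)^(1/2) / (1 - r_j), produce W
    L^(p/2); passing from G to the L^2 norm sqrt (mu_f G) halves these exponents, whence W^(1/2) and
    L^(p/4). Only countably many random events can be controlled almost surely. Hence the grid
    depends on N alone, N runs through all integers, and r enters afterwards through the choice of
    N. The almost sure constant depends on t; so does the corner near the vertex where it is
    absorbed, while the sets where the moments are large do not. *)

Section OneVariable.
Context {R : realType}.
Local Notation mu := (@lebesgue_measure R).

Lemma cvg_powR_comp (u : R -> R) (e x : R) : {for x, continuous u} -> 0 < u x ->
  (fun y => u y `^ e) @ x --> u x `^ e.
Proof.
move=> cu ux.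
have cp : {for u x, continuous (fun z : R => z `^ e)}.
  apply/differentiable_continuous/derivable1_diffP.
  by have [] := @is_derive1_powR R e _ ux.
exact: (cvg_comp _ _ cu cp).
Qed.

(** The primitive - u^(-d)/d increases by at most u(a)^(-d)/d, hence the bound is uniform in u and
    in the interval. *)
Lemma integral_dlog_powR (u du : R -> R) (a b d : R) : a < b -> 0 < d ->
  (forall x, a <= x <= b -> is_derive x 1 u (du x)) ->
  (forall x, a <= x <= b -> {for x, continuous du}) ->
  (forall x, a <= x <= b -> 1 <= u x) ->
  (\int[mu]_(x in `[a, b]) (du x / u x `^ (1 + d))%:E <= (d^-1)%:E)%E.
Proof.
move=> ab d0 hu cdu u1.
have u0 x : a <= x <= b -> 0 < u x by move=> /u1; exact: lt_le_trans.
pose F x := - d^-1 * u x `^ (- d).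
have dF x : a <= x <= b -> is_derive x 1 F (du x / u x `^ (1 + d)).
  move=> xab; have ux := u0 _ xab.
  have h1 := hu _ xab; have h2 := @is_derive1_powR R (- d) _ ux.
  have h3 := is_derive1_comp h2 h1.
  rewrite /F; apply: is_derive_eq.
  rewrite /GRing.scale /= -powRN opprD addrC.
  field; exact: lt0r_neq0.
have cu x : a <= x <= b -> {for x, continuous u}.
  by move=> /hu hx; apply/differentiable_continuous/derivable1_diffP; case: hx.
have cf : {in `[a, b], continuous (fun x => du x / u x `^ (1 + d))}.
  move=> x; rewrite in_itv/= => xab; have ux := u0 _ xab.
  apply: cvgM; first exact: cdu.
  apply: cvgV; first by rewrite gt_eqF// powR_gt0.
  by apply: cvg_powR_comp => //; exact: cu.
have cF x : a <= x <= b -> {for x, continuous F}.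
  by move=> /dF hx; apply/differentiable_continuous/derivable1_diffP; case: hx.
rewrite (@continuous_FTC2 _ _ F)//; first last.
- by move=> x xab; rewrite derive1E; apply/derive_val/dF;
    move: xab; rewrite in_itv/= => /andP[/ltW -> /ltW ->].
- split.
  + move=> x xab; have [] // : is_derive x 1 F (du x / u x `^ (1 + d)).
    by apply: dF; move: xab; rewrite in_itv/= => /andP[/ltW -> /ltW ->].
  + by apply/cvg_at_right_filter/cF; rewrite lexx ltW.
  + by apply/cvg_at_left_filter/cF; rewrite lexx ltW.
- by apply: continuous_in_subspaceT => x; rewrite inE; exact: cf.
rewrite -EFinB lee_fin /F !mulNr opprK addrC.
have ua : u a `^ (- d) <= 1.
  rewrite powRN invf_le1; last by rewrite powR_gt0// u0// lexx ltW.
  apply: (@le_trans _ _ (1 `^ d)); first by rewrite powR1.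
  apply: ge0_ler_powR; rewrite ?nnegrE//.
  - exact: ltW.
  - by rewrite ltW// u0// lexx ltW.
  - by rewrite u1// lexx ltW.
rewrite -mulrBr -[leRHS]mulr1 ler_pM2l ?invr_gt0//.
by rewrite lerBlDr (le_trans ua)// lerDl powR_ge0.
Qed.

Lemma continuous_itv_measurable (f : R -> R) (a b : R) :
  {in `[a, b], continuous f} -> measurable_fun `[a, b] f.
Proof.
move=> cf; apply: subspace_continuous_measurable_fun => //.
by apply: continuous_in_subspaceT => x; rewrite inE; exact: cf.
Qed.

Variables (P : {poly R}) (c rho d : R).
Hypotheses (c0 : 0 < c) (rho0 : 0 < rho) (rho1 : rho < 1) (d0 : 0 < d).
Hypothesis Pc : forall x, rho <= x <= 1 -> c <= P.[x].
(** For P = sum c_k x^k these are sum k c_k x^k and sum k^2 c_k x^k: H/P and K/P are the first two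
    moments of an exponent k drawn with weight c_k x^k. *)
Local Notation H := ('X * P^`()).
Local Notation K := ('X * H^`()).
Hypothesis H0 : forall x, rho <= x <= 1 -> 0 <= H.[x].
Hypothesis V0 : forall x, rho <= x <= 1 -> 0 <= K.[x] / P.[x] - (H.[x] / P.[x]) ^+ 2.

Let P0 x : rho <= x <= 1 -> 0 < P.[x].
Proof. by move=> /Pc; exact: lt_le_trans. Qed.

Let x0 x : rho <= x <= 1 -> 0 < x.
Proof. by move=> /andP[+ _]; exact: lt_le_trans. Qed.

Let cP (Q : {poly R}) x : rho <= x <= 1 ->
  {for x, continuous (fun x => Q.[x] / P.[x])}.
Proof.
move=> xr; apply: cvgM; first exact: continuous_horner.
by apply: cvgV; [rewrite gt_eqF// P0|exact: continuous_horner].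
Qed.

Let dP' x : rho <= x <= 1 -> 0 <= P^`().[x].
Proof.
by move=> xr; have := H0 xr; rewrite hornerM hornerX pmulr_rge0// x0.
Qed.

(** With u = 1 + ln (P/c), u' = P'/P, and H/P = x u' is at most u' because x <= 1. *)
Lemma fibre_mean :
  (\int[mu]_(x in `[rho, 1%R])
     (H.[x] / P.[x] / (1 + ln (P.[x] / c)) `^ (1 + d))%:E <= (d^-1)%:E)%E.
Proof.
pose u x := 1 + ln (P.[x] / c).
have u1 x : rho <= x <= 1 -> 1 <= u x.
  by move=> xr; rewrite lerDl ln_ge0// ler_pdivlMr// mul1r Pc.
have du x : rho <= x <= 1 -> is_derive x 1 u (P^`().[x] / P.[x]).
  move=> xr; have px : 0 < P.[x] / c by rewrite divr_gt0// P0.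
  have h2 := @is_derive1_ln R _ px.
  have h1 : is_derive x 1 (fun x => P.[x] / c) (P^`().[x] / c).
    rewrite (_ : (fun x => _) = horner (c^-1 *: P)); last first.
      by apply/funext => y; rewrite hornerZ mulrC.
    by apply: is_derive_eq; rewrite derivZ hornerZ mulrC.
  have h3 := @is_derive1_comp R (@ln R) (fun y => P.[y] / c) x _ _ h2 h1.
  rewrite /u; apply: is_derive_eq.
  rewrite add0r /GRing.scale/=; field; rewrite gt_eqF ?P0//=; exact: lt0r_neq0.
have cdu x : rho <= x <= 1 -> {for x, continuous (fun x => P^`().[x] / P.[x])}.
  exact: cP.
have cu x : rho <= x <= 1 -> {for x, continuous u}.
  by move=> /du hx; apply/differentiable_continuous/derivable1_diffP; case: hx.
have cpow : {in `[rho, 1], continuous (fun x => (u x `^ (1 + d))^-1)}.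
  move=> x; rewrite in_itv/= => xr.
  have ux : 0 < u x by rewrite (lt_le_trans _ (u1 _ xr)).
  apply: cvgV; first by rewrite gt_eqF// powR_gt0.
  by apply: cvg_powR_comp => //; exact: cu.
apply: le_trans (integral_dlog_powR rho1 d0 du cdu u1).
apply: ge0_le_integral => //=.
- move=> x; rewrite /= in_itv/= => xr; rewrite lee_fin divr_ge0 ?powR_ge0//.
  by rewrite divr_ge0 ?H0// ltW// P0.
- apply/measurable_EFinP; apply: continuous_itv_measurable => x xr.
  apply: cvgM; last exact: cpow.
  by apply: cP; move: xr; rewrite in_itv.
- apply/measurable_EFinP; apply: continuous_itv_measurable => x xr.
  apply: cvgM; last exact: cpow.
  by apply: cP; move: xr; rewrite in_itv.
- move=> x; rewrite /= in_itv/= => xr; rewrite lee_fin ler_wpM2r ?invr_ge0 ?powR_ge0//.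
  rewrite ler_wpM2r ?invr_ge0 ?(ltW (P0 _))// hornerM hornerX ler_piMl ?dP'//.
  by case/andP: xr.
Qed.

(** The mean u = 1 + H/P has derivative v/x, where v is the variance; again x <= 1. *)
Lemma fibre_variance :
  (\int[mu]_(x in `[rho, 1%R])
     ((K.[x] / P.[x] - (H.[x] / P.[x]) ^+ 2) /
        (1 + H.[x] / P.[x]) `^ (1 + d))%:E <= (d^-1)%:E)%E.
Proof.
pose u x := 1 + H.[x] / P.[x].
pose v x := K.[x] / P.[x] - (H.[x] / P.[x]) ^+ 2.
have u1 x : rho <= x <= 1 -> 1 <= u x.
  by move=> xr; rewrite lerDl divr_ge0 ?H0// ltW// P0.
have du x : rho <= x <= 1 -> is_derive x 1 u (v x / x).
  move=> xr; have px := P0 xr; have xp := x0 xr.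
  have pn : P.[x] != 0 by rewrite gt_eqF.
  have h2 := @is_deriveV _ (horner P) x _ 1 pn (is_derive_poly _ _).
  have h1 := is_derive_poly H x.
  have h3 := is_deriveM h1 h2.
  rewrite (_ : u = cst 1 + horner H * (fun y => (P.[y])^-1)); last by [].
  apply: is_derive_eq.
  rewrite add0r /GRing.scale/= /v !hornerM hornerX /=.
  by field; rewrite !gt_eqF.
have cv x : rho <= x <= 1 -> {for x, continuous v}.
  move=> xr; apply: cvgB; first exact: cP.
  by apply: cvgM; exact: cP.
have cdu x : rho <= x <= 1 -> {for x, continuous (fun x => v x / x)}.
  move=> xr; apply: cvgM; first exact: cv.
  by apply: cvgV; [rewrite gt_eqF// x0|exact: cvg_id].
have cu x : rho <= x <= 1 -> {for x, continuous u}.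
  by move=> /du hx; apply/differentiable_continuous/derivable1_diffP; case: hx.
have cpow : {in `[rho, 1], continuous (fun x => (u x `^ (1 + d))^-1)}.
  move=> x; rewrite in_itv/= => xr.
  have ux : 0 < u x by rewrite (lt_le_trans _ (u1 _ xr)).
  apply: cvgV; first by rewrite gt_eqF// powR_gt0.
  by apply: cvg_powR_comp => //; exact: cu.
apply: le_trans (integral_dlog_powR rho1 d0 du cdu u1).
apply: ge0_le_integral => //=.
- by move=> x; rewrite /= in_itv/= => xr; rewrite lee_fin divr_ge0 ?powR_ge0 ?V0.
- apply/measurable_EFinP; apply: continuous_itv_measurable => x xr.
  apply: cvgM; last exact: cpow.
  by apply: cv; move: xr; rewrite in_itv.
- apply/measurable_EFinP; apply: continuous_itv_measurable => x xr.
  apply: cvgM; last exact: cpow.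
  by apply: cdu; move: xr; rewrite in_itv.
- move=> x; rewrite /= in_itv/= => xr; rewrite lee_fin ler_wpM2r ?invr_ge0 ?powR_ge0//.
  by rewrite ler_pdivlMr ?x0// ler_piMr ?V0//; case/andP: xr.
Qed.

End OneVariable.

(** * Tonelli's theorem on tuples *)

Section TonelliTuple.
Context {R : realType}.
Local Notation mu := (@lebesgue_measure R).
Local Open Scope ereal_scope.

Definition tuple_upd (p : nat) (u : Rtuple R p) (j : 'I_p) (x : R) : Rtuple R p :=
  [tuple (if i == j then x else tnth u i) | i < p].

Lemma lebesgue_tuple_cons_integral (p : nat) (F : Rtuple R p.+1 -> \bar R) :
  measurable_fun setT F -> (forall u, 0 <= F u) ->
  \int[lebesgue_tuple p.+1]_u F u =
  \int[(mu \x lebesgue_tuple p)]_z F (cons_pair z).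
Proof.
move=> mF F0.
rewrite [LHS](@ge0_integral_pushforward _ _ _ _ R (@cons_pair R p)
  (@measurable_cons_pair R p) (mu \x lebesgue_tuple p) setT F)//.
Qed.

Lemma cons_pair_measurable_comp (p : nat) (F : Rtuple R p.+1 -> \bar R) :
  measurable_fun setT F -> measurable_fun setT (F \o @cons_pair R p).
Proof. by move=> mF; apply: measurableT_comp => //; exact: measurable_cons_pair. Qed.

Lemma lebesgue_tuple_cons_integral1 (p : nat) (F : Rtuple R p.+1 -> \bar R) :
  measurable_fun setT F -> (forall u, 0 <= F u) ->
  \int[lebesgue_tuple p.+1]_u F u =
  \int[mu]_x \int[lebesgue_tuple p]_u F (cons_pair (x, u)).
Proof.
move=> mF F0; rewrite lebesgue_tuple_cons_integral//.
exact: (fubini_tonelli1 _ (cons_pair_measurable_comp mF) (fun z => F0 _)).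
Qed.

Lemma lebesgue_tuple_cons_integral2 (p : nat) (F : Rtuple R p.+1 -> \bar R) :
  measurable_fun setT F -> (forall u, 0 <= F u) ->
  \int[lebesgue_tuple p.+1]_u F u =
  \int[lebesgue_tuple p]_u \int[mu]_x F (cons_pair (x, u)).
Proof.
move=> mF F0; rewrite lebesgue_tuple_cons_integral//.
exact: (fubini_tonelli2 _ (cons_pair_measurable_comp mF) (fun z => F0 _)).
Qed.

Lemma measurable_prod_tnth (p : nat) (w : R -> R) :
  measurable_fun setT w ->
  measurable_fun setT (fun u : Rtuple R p => (\prod_(i < p) w (tnth u i))%R%:E).
Proof.
move=> mw; apply/measurable_EFinP.
apply: measurable_prod => i _.
by apply: measurableT_comp => //; exact: measurable_tnth.
Qed.

Lemma integral_prod_tnth_le (p : nat) (w : R -> R) (C : R) :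
  measurable_fun setT w -> (forall x, (0 <= w x)%R) -> (0 <= C)%R ->
  \int[mu]_x (w x)%:E <= C%:E ->
  \int[lebesgue_tuple p]_u (\prod_(i < p) w (tnth u i))%R%:E <= (C ^+ p)%:E.
Proof.
move=> mw w0 C0 wC; elim: p => [|p IH].
  rewrite (eq_integral (cst 1)).
    by rewrite integral_cst//= diracT mule1.
  by move=> u _; rewrite big_ord0.
rewrite lebesgue_tuple_cons_integral1; first last.
- by move=> u; rewrite lee_fin prodr_ge0.
- exact: measurable_prod_tnth.
pose I := \int[lebesgue_tuple p]_u (\prod_(i < p) w (tnth u i))%R%:E.
rewrite (@eq_integral _ _ _ mu setT (fun x : measurableTypeR R => I * (w x)%:E)); last first.
  move=> x _; rewrite muleC -ge0_integralZl//; first last.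
  - by rewrite lee_fin.
  - by move=> u _; rewrite lee_fin prodr_ge0.
  - exact: measurable_prod_tnth.
  apply: eq_integral => u _ /=; rewrite -EFinM; congr EFin.
  by rewrite big_ord_recl /=; congr (_ * _)%R; apply: eq_bigr => i _; rewrite tnthS.
rewrite ge0_integralZl//; first last.
- by apply: integral_ge0 => u _; rewrite lee_fin prodr_ge0.
- by move=> x _; rewrite lee_fin.
- exact/measurable_EFinP.
rewrite exprS EFinM [leRHS]muleC.
apply: lee_pmul => //.
- by apply: integral_ge0 => u _; rewrite lee_fin prodr_ge0.
- by apply: integral_ge0 => u _; rewrite lee_fin.
Qed.

(** Tonelli with the coordinate j integrated innermost. The recursive structure of [lebesgue_tuple]
    only lets the first coordinate be peeled off, whence the induction on p. *)
Lemma integral_tuple_fibre_le (p : nat) (j : 'I_p) (F : Rtuple R p -> \bar R)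
    (w : R -> R) (C K : R) :
  measurable_fun setT F -> (forall u, 0 <= F u) ->
  measurable_fun setT w -> (forall x, (0 <= w x)%R) -> (0 <= C)%R -> (0 <= K)%R ->
  \int[mu]_x (w x)%:E <= C%:E ->
  (forall u, \int[mu]_x F (tuple_upd u j x) <=
     (K * \prod_(i < p | i != j) w (tnth u i))%R%:E) ->
  \int[lebesgue_tuple p]_u F u <= (K * C ^+ p.-1)%:E.
Proof.
move=> mF F0 mw w0 C0 + wC; elim: p j F mF F0 K => [[]//|p IH j F mF F0 K K0 hF].
have mc := cons_pair_measurable_comp mF.
have c0 z : 0 <= (F \o @cons_pair R p) z by exact: F0.
have [j' jE|jE] := unliftP ord0 j.
- rewrite lebesgue_tuple_cons_integral1//.
  have p0 : (0 < p)%N by case: j' {jE} => m; case: p {IH F mF F0 hF mc c0 j}.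
  (* j is not the first coordinate: freeze the first one at x and let its weight w x join the
     constant K. *)
  have step x : \int[lebesgue_tuple p]_u F (cons_pair (x, u)) <=
      (K * w x * C ^+ p.-1)%:E.
    apply: (IH j').
    + by have := measurable_fun_pair2 x mc.
    + by [].
    + by rewrite mulr_ge0.
    move=> u; have := hF (cons_pair (x, u)); congr (_ <= _).
      apply: eq_integral => y _; congr F; apply: eq_from_tnth => i.
      rewrite tnth_mktuple jE; have [k ->|->] := unliftP ord0 i.
        rewrite (inj_eq lift_inj) !tnthS tnth_mktuple.
        by [].
      by rewrite (negbTE (neq_lift _ _))//.
    rewrite -mulrA big_mkcond big_ord_recl jE eq_liftF/=.
    congr ((_ * (_ * _))%R)%:E.
    rewrite [RHS]big_mkcond; apply: eq_bigr => i _.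
    by rewrite (inj_eq lift_inj) tnthS.
  apply: (@le_trans _ _ (\int[mu]_x (K * w x * C ^+ p.-1)%:E)).
    apply: ge0_le_integral => //=.
    - by move=> x _; exact: integral_ge0.
    - exact: (measurable_fun_fubini_tonelli_F _ mc).
    - apply/measurable_EFinP; apply: measurable_funM => //.
      exact: measurable_funM.
  under eq_integral => x _ do rewrite mulrAC EFinM.
  rewrite ge0_integralZl//; first last.
  - by rewrite lee_fin mulr_ge0 ?exprn_ge0.
  - by move=> x _; rewrite lee_fin.
  - exact/measurable_EFinP.
  rewrite [leRHS](_ : _ = (K * C ^+ p.-1)%:E * C%:E); last first.
    by rewrite -EFinM -mulrA -exprSr prednK.
  by apply: lee_wpmul2l => //; rewrite lee_fin mulr_ge0 ?exprn_ge0.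
- rewrite lebesgue_tuple_cons_integral2//.
  (* j is the first coordinate: its fibre bound leaves the product of all remaining weights. *)
  have step u : \int[mu]_x F (cons_pair (x, u)) <=
      (K * \prod_(i < p) w (tnth u i))%:E.
    have := hF (cons_pair (0%R, u)); congr (_ <= _).
      apply: eq_integral => y _; congr F; apply: eq_from_tnth => i.
      rewrite tnth_mktuple jE; have [k ->|->] := unliftP ord0 i.
        by rewrite eq_sym (negbTE (neq_lift _ _)) !tnthS.
      by rewrite eqxx.
    rewrite big_mkcond big_ord_recl jE eqxx/= mul1r.
    congr ((_ * _)%R)%:E; apply: eq_bigr => i _.
    by rewrite tnthS.
  apply: (@le_trans _ _ (\int[lebesgue_tuple p]_u (K * \prod_(i < p) w (tnth u i))%:E)).
    apply: ge0_le_integral => //=.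
    - by move=> x _; exact: integral_ge0.
    - exact: (measurable_fun_fubini_tonelli_G _ mc).
    - apply/measurable_EFinP; apply: measurable_funM => //.
      by apply/measurable_EFinP; exact: measurable_prod_tnth.
  under eq_integral => x _ do rewrite EFinM.
  rewrite ge0_integralZl//; first last.
  - by move=> x _; rewrite lee_fin prodr_ge0.
  - exact: measurable_prod_tnth.
  by rewrite EFinM lee_wpmul2l// ?lee_fin// integral_prod_tnth_le.
Qed.

End TonelliTuple.

(** * Sets of finite logarithmic measure *)

Section ExceptionalSets.
Context {R : realType}.
Local Notation mu := (@lebesgue_measure R).

(** The class of exceptional sets is defined with the completed measure, while every set built here
    is Borel. The identity, measurable from the completed to the Borel sigma-algebra, pushes one
    measure to the other. *)
Lemma complete_lebesgue_integral (p : nat) (D : set (Rtuple R p))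
    (f : Rtuple R p -> \bar R) :
  measurable D -> measurable_fun D f -> (forall x, D x -> 0 <= f x)%E ->
  (\int[@complete_lebesgue R p]_(x in D) f x =
   \int[lebesgue_tuple p]_(x in D) f x)%E.
Proof.
move=> mD mf f0.
pose T := caratheodory_type ((@lebesgue_tuple R p)^*)%mu.
pose phi : T -> Rtuple R p := id.
have sub (A : set (Rtuple R p)) : (@measurable _ (Rtuple R p)) A ->
    (((@lebesgue_tuple R p)^*)%mu).-cara.-measurable A.
  by move=> mA; apply: sub_caratheodory; apply: sub_sigma_algebra; exact: mA.
have mphi : measurable_fun setT phi.
  by move=> _ A mA; rewrite setTI; exact: sub.
transitivity (\int[pushforward (@complete_lebesgue R p) phi]_(x in D) f x)%E.
  rewrite (@ge0_integral_pushforward _ _ _ _ R phi mphi)//.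
  by move=> x; rewrite inE; exact: f0.
apply: eq_measure_integral => A mA _.
exact: (@measurable_mu_extE _ R (Rtuple R p) (lebesgue_tuple p) A mA).
Qed.

Lemma measurable_funV_ge0 d (T : measurableType d) (D : set T) (f : T -> R) :
  measurable_fun D f -> (forall x, D x -> 0 <= f x) ->
  measurable_fun D (fun x => (f x)^-1).
Proof.
move=> mf f0; apply: (@eq_measurable_fun _ _ _ _ _ (fun x => f x `^ (-1))).
  by move=> x; rewrite inE => /f0 fx; rewrite powR_inv1.
by apply: (@measurableT_comp _ _ _ _ _ _ (@powR R ^~ (-1))) => //; exact: measurable_powR.
Qed.

(* The shift e > 0 removes the singularity of (1 - x)^(d - 1) at x = 1; it is sent
   to 0 by Fatou's lemma. *)
Definition edge_weight (d e x : R) : R := \1_(`[0, 1] : set R) x * (1 - x + e) `^ (d - 1).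

Lemma edge_weight_ge0 (d e x : R) : 0 <= edge_weight d e x.
Proof. by rewrite /edge_weight mulr_ge0// powR_ge0. Qed.

Lemma measurable_edge_weight (d e : R) : measurable_fun setT (edge_weight d e).
Proof.
apply: measurable_funM; first exact: measurable_indic.
apply: (@measurableT_comp _ _ _ _ _ _ (@powR R ^~ (d - 1))).
  exact: measurable_powR.
by apply: measurable_funD => //; exact: measurable_funB.
Qed.

(** On [0, 1] the weight equals 2^d u'/u^(1+d) for u = 2/(1 - x + e); the numerator 2 and e <= 1
    ensure u >= 1. *)
Lemma integral_edge_weight_le (d e : R) : 0 < d -> 0 < e <= 1 ->
  (\int[mu]_x (edge_weight d e x)%:E <= (2 `^ d / d)%:E)%E.
Proof.
move=> d0 /andP[e0 e1].
pose y (x : R) : R := 1 - x + e.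
have y0 (x : R) : 0 <= x <= 1 -> 0 < y x.
  by move=> /andP[_ x1]; rewrite /y; lra.
pose u (x : R) : R := 2 / y x.
pose du (x : R) : R := 2 / (y x) ^+ 2.
have dy (x : R) : is_derive x 1 y (-1).
  have -> : y = cst (1 + e) - id by apply/funext => z; rewrite /y/= !fctE; ring.
  by apply: is_derive_eq; rewrite sub0r.
have hu (x : R) : 0 <= x <= 1 -> is_derive x 1 u (du x).
  move=> x01; have yx := y0 _ x01.
  have yn : y x != 0 by rewrite gt_eqF.
  have h := @is_deriveV _ y x _ 1 yn (dy x).
  rewrite (_ : u = 2 *: (fun z => (y z)^-1)); last by [].
  apply: is_derive_eq; rewrite /du /GRing.scale/=; field.
  exact: yn.
have cy (x : R) : {for x, continuous y}.
  by apply/differentiable_continuous/derivable1_diffP; case: (dy x).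
have := @integral_dlog_powR R u du 0 1 d ltr01 d0 hu.
have -> : (\int[mu]_x (edge_weight d e x)%:E =
    (2 `^ d)%:E * \int[mu]_(x in `[0%R, 1%R]) (du x / u x `^ (1 + d))%:E)%E.
  have E (x : R) : 0 <= x <= 1 -> (y x) `^ (d - 1) = 2 `^ d * (du x / u x `^ (1 + d)).
    move=> x01; have yx := y0 _ x01.
    have yn : y x != 0 by rewrite gt_eqF.
    have iy : (y x)^-1 `^ d = (y x `^ d)^-1.
      by rewrite -(powR_inv1 (ltW yx)) -powRrM mulN1r powRN.
    rewrite powRB; last by rewrite yn implybT.
    rewrite powRr1 ?ltW// /u /du powRD; last first.
      by apply/implyP => _; rewrite gt_eqF// divr_gt0.
    rewrite powRr1; last by rewrite divr_ge0// ltW.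
    rewrite powRM ?invr_ge0 ?ltW// iy; field.
    by rewrite yn/= !gt_eqF// powR_gt0.
  rewrite -ge0_integralZl//=; first last.
  - move=> x; rewrite in_itv/= => x01; rewrite lee_fin.
    by have := powR_ge0 (y x) (d - 1); rewrite E// pmulr_rge0// powR_gt0.
  - apply/measurable_EFinP; apply: continuous_itv_measurable => x.
    rewrite in_itv/= => x01; have yx := y0 _ x01.
    have cu : {for x, continuous u}.
      by apply/differentiable_continuous/derivable1_diffP; case: (hu _ x01).
    apply: cvgM.
      apply: cvgM; first exact: cvg_cst.
      apply: cvgV; first by rewrite expf_eq0/= gt_eqF.
      by apply: cvgM; exact: cy.
    have ux : 0 < u x by rewrite divr_gt0.
    by apply: cvgV; [rewrite gt_eqF// powR_gt0|exact: cvg_powR_comp].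
  rewrite [RHS]integral_mkcond; apply: eq_integral => x _.
  rewrite patchE /edge_weight indicE; case: ifPn => [|_]; last by rewrite mul0r.
  by rewrite inE/= in_itv/= => x01; rewrite mul1r E.
move=> h; rewrite EFinM lee_wpmul2l// ?lee_fin ?powR_ge0//.
apply: h => x x01; have yx := y0 _ x01.
  apply: cvgM; first exact: cvg_cst.
  apply: cvgV; first by rewrite expf_eq0/= gt_eqF.
  by apply: cvgM; exact: cy.
by rewrite /u ler_pdivlMr// mul1r /y; lra.
Qed.

End ExceptionalSets.

(** * Logarithmic measure of an exceptional set, from bounds along fibres *)

Section LogMeasureFinite.
Context {R : realType} (p : nat).
Local Notation mu := (@lebesgue_measure R).

(** Two corners are needed: the approximants are controlled up to the endpoint 1, their limit exists
    only below it. *)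
Definition closed_corner (rho : R) : set (Rtuple R p) :=
  [set u | forall i, rho <= (tnth u i : R) <= 1].

Definition open_corner (rho : R) : set (Rtuple R p) :=
  [set u | forall i, rho <= (tnth u i : R) < 1].

Definition logw (u : Rtuple R p) : R := \prod_(i < p) (1 - (tnth u i : R))^-1.

Lemma measurable_tnth_all (I : set R) : measurable I ->
  measurable [set u : Rtuple R p | forall i, I (tnth u i)].
Proof.
move=> mI; rewrite (_ : [set u | _] = \bigcap_(j in [set: 'I_p])
    ((fun u : Rtuple R p => tnth u j) @^-1` I)); last first.
  by apply/seteqP; split => [u h j _|u h j] /=; [exact: h|exact: (h j)].
apply: fin_bigcap_measurable => // j _.
by rewrite -[X in measurable X]setTI; exact: measurable_tnth.
Qed.

Lemma measurable_closed_corner rho : measurable (closed_corner rho).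
Proof.
rewrite (_ : closed_corner rho =
    [set u : Rtuple R p | forall i, (`[rho, 1]%classic : set R) (tnth u i)]).
  exact: measurable_tnth_all.
by apply/seteqP; split => u /= h i; have := h i; rewrite in_itv.
Qed.

Lemma measurable_open_corner rho : measurable (open_corner rho).
Proof.
rewrite (_ : open_corner rho =
    [set u : Rtuple R p | forall i, (`[rho, 1[%classic : set R) (tnth u i)]).
  exact: measurable_tnth_all.
by apply/seteqP; split => u /= h i; have := h i; rewrite in_itv.
Qed.

Lemma open_corner_closed rho : open_corner rho `<=` closed_corner rho.
Proof. by move=> u h i; have /andP[-> /ltW] := h i. Qed.

Lemma open_corner_gt0 rho u i : open_corner rho u -> 0 < 1 - (tnth u i : R).
Proof. by move=> /(_ i)/andP[_]; rewrite subr_gt0. Qed.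

Lemma logw_ge0 rho u : open_corner rho u -> 0 <= logw u.
Proof.
by move=> h; apply: prodr_ge0 => i _; rewrite invr_ge0 ltW// (open_corner_gt0 _ h).
Qed.

Lemma measurable_logw rho : measurable_fun (open_corner rho) logw.
Proof.
apply: measurable_prod => i _; apply: measurable_funV_ge0.
  apply: measurable_funB => //.
  exact: measurable_funS (@measurable_tnth _ (measurableTypeR R) p i).
by move=> u h; rewrite ltW// (open_corner_gt0 _ h).
Qed.

Lemma powR_prod (I : Type) (s : seq I) (P : pred I) (f : I -> R) (d : R) :
  (forall i, P i -> 0 <= f i) ->
  (\prod_(i <- s | P i) f i) `^ d = \prod_(i <- s | P i) f i `^ d.
Proof.
move=> f0; elim: s => [|x s IH]; first by rewrite !big_nil powR1.
rewrite !big_cons; case: ifPn => // Px; rewrite powRM ?f0 ?IH//.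
exact: prodr_ge0.
Qed.

Variables (j : 'I_p) (rho d K : R).
Hypotheses (rho0 : 0 < rho) (rho1 : rho < 1) (d0 : 0 < d) (K0 : 0 <= K).
Variables (FN : nat -> Rtuple R p -> R) (F : Rtuple R p -> R).
Hypothesis mFN : forall n, measurable_fun (closed_corner rho) (FN n).
Hypothesis FN0 : forall n u, closed_corner rho u -> 0 <= FN n u.
Hypothesis FNF : forall u, open_corner rho u -> FN n u @[n --> \oo] --> F u.
Hypothesis fibre : forall n u, closed_corner rho u ->
  (\int[mu]_(x in `[rho, 1%R]) (FN n (tuple_upd u j x))%:E <= K%:E)%E.

Definition exceptional_set : set (Rtuple R p) :=
  [set u | open_corner rho u /\
           (1 - (tnth u j : R))^-1 * logw u `^ d < F u].

Let mF : measurable_fun (open_corner rho) F.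
Proof.
apply: (@measurable_fun_cvg _ _ _ _ FN) => // n.
apply: measurable_funS (mFN n); first exact: measurable_closed_corner.
exact: open_corner_closed.
Qed.

Lemma measurable_exceptional_set : measurable exceptional_set.
Proof.
rewrite (_ : exceptional_set = open_corner rho `&`
   (fun u => (1 - (tnth u j : R))^-1 * logw u `^ d < F u) @^-1` [set true])//.
apply: measurable_fun_ltr => //; last exact: measurable_open_corner.
apply: measurable_funM.
  apply: measurable_funV_ge0.
    apply: measurable_funB => //.
    exact: measurable_funS (@measurable_tnth _ (measurableTypeR R) p j).
  by move=> u h; rewrite ltW// (open_corner_gt0 _ h).
apply: (@measurableT_comp _ _ _ _ _ _ (@powR R ^~ d)); first exact: measurable_powR.
exact: measurable_logw.
Qed.

(* On the exceptional set logw u <= F u * \prod_(i != j) (1 - u_i)^(d - 1), whose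
   right-hand side is the limit of G n u; integrating G n first in the variable j
   leaves a product of integrable weights. *)
Let w n := edge_weight d (@harmonic R n).

Let G n (u : Rtuple R p) : \bar R :=
  ((fun u => (FN n u * \prod_(i < p | i != j) w n (tnth u i))%:E)
    \_ (closed_corner rho)) u.

Let G0 n u : (0 <= G n u)%E.
Proof.
rewrite /G patchE; case: ifPn => // /set_mem uC.
by rewrite lee_fin mulr_ge0 ?FN0// prodr_ge0// => i _; exact: edge_weight_ge0.
Qed.

Let mG n : measurable_fun setT (G n).
Proof.
apply/(measurable_restrictT _ (measurable_closed_corner rho)).
apply/measurable_EFinP; apply: measurable_funM => //.
apply: (@measurable_funS _ _ _ _ setT) => //.
under eq_fun do rewrite big_mkcond.
apply: measurable_prod => i _; case: (i != j) => //.
apply: measurableT_comp; [exact: measurable_edge_weight|exact: measurable_tnth].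
Qed.

Let harmonic01 n : 0 < @harmonic R n <= 1.
Proof. by rewrite /harmonic/= invr_gt0 ltr0n/= invf_le1 ?ltr0n// ler1n. Qed.

Let intG n : (\int[lebesgue_tuple p]_u G n u <= (K * (2 `^ d / d) ^+ p.-1)%:E)%E.
Proof.
apply: (@integral_tuple_fibre_le _ _ j (G n) (w n)) => //.
- exact: measurable_edge_weight.
- by move=> x; exact: edge_weight_ge0.
- by rewrite divr_ge0 ?powR_ge0// ltW.
- exact: integral_edge_weight_le.
move=> u.
have prod0 : 0 <= \prod_(i < p | i != j) w n (tnth u i).
  by apply: prodr_ge0 => i _; exact: edge_weight_ge0.
have [uC|uC] := pselect (forall i, i != j -> rho <= (tnth u i : R) <= 1); last first.
  rewrite (eq_integral (cst 0%E)); first by rewrite integral0 lee_fin mulr_ge0.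
  move=> x _; rewrite /G patchE; case: ifPn => // /set_mem h.
  by exfalso; apply: uC => i ij; have := h i; rewrite tnth_mktuple (negbTE ij).
(* [fibre] needs a base point in the closed corner, while u_j is arbitrary; resetting it to 1 does
   not change the fibre. *)
pose v := tuple_upd u j 1.
have vC : closed_corner rho v.
  move=> i; rewrite tnth_mktuple; case: eqVneq => [_|ij]; last exact: uC.
  by rewrite lexx ltW.
have updv x : tuple_upd v j x = tuple_upd u j x.
  by apply: eq_from_tnth => i; rewrite !tnth_mktuple; case: eqVneq.
have updC x : (tuple_upd u j x \in closed_corner rho) = (x \in `[rho, 1]).
  apply/idP/idP; first by rewrite inE => /(_ j); rewrite tnth_mktuple eqxx in_itv.
  rewrite in_itv/= => xr; rewrite inE => i; rewrite tnth_mktuple.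
  by case: eqVneq => // ij; exact: uC.
have -> : (\int[mu]_x G n (tuple_upd u j x) =
   (\prod_(i < p | i != j) w n (tnth u i))%:E *
     \int[mu]_(x in `[rho, 1%R]) (FN n (tuple_upd v j x))%:E)%E.
  rewrite -ge0_integralZl//=; first last.
  - by move=> x xr; rewrite lee_fin updv FN0//; apply/set_mem; rewrite updC.
  - apply/measurable_EFinP.
    apply: (@measurable_comp _ _ _ _ _ _ (closed_corner rho)) (mFN n) _.
    + exact: measurable_closed_corner.
    + by move=> _ [x xr <-]; apply/set_mem; rewrite updv updC.
    + apply: (@measurable_funS _ _ _ _ setT) => //.
      apply/measurable_fun_tnthP => i.
      rewrite (_ : _ \o _ = fun x => if i == j then x else tnth v i).
        by case: eqVneq.
      by apply/funext => x /=; rewrite tnth_mktuple.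
  rewrite [RHS]integral_mkcond; apply: eq_integral => x _.
  rewrite /G !patchE updC mem_setE; case: ifP => // _.
  rewrite updv -EFinM mulrC; congr (_ * _)%:E.
  by apply: eq_bigr => i ij; rewrite tnth_mktuple (negbTE ij).
by rewrite muleC EFinM; apply: lee_wpmul2r; [rewrite lee_fin|exact: fibre].
Qed.

Let Glim u : exceptional_set u ->
  ((logw u)%:E <= limn_einf (G^~ u))%E.
Proof.
move=> [uo uF].
pose t i : R := 1 - (tnth u i : R).
have t0 i : 0 < t i by exact: open_corner_gt0 uo.
have t1 i : t i <= 1.
  by have /andP[h _] := uo i; rewrite /t lerBlDr lerDl (le_trans (ltW rho0)).
have cw i : w n (tnth u i) @[n --> \oo] --> t i `^ (d - 1).
  have e n : w n (tnth u i) = (t i + @harmonic R n) `^ (d - 1).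
    rewrite /w /edge_weight indicE mem_set ?mul1r//= in_itv/=.
    by have /andP[h /ltW ->] := uo i; rewrite (le_trans (ltW rho0)).
  under eq_fun do rewrite e.
  have cp : {for t i, continuous (fun z : R => z `^ (d - 1))}.
    by apply: cvg_powR_comp => //; exact: cvg_id.
  have ch : t i + @harmonic R n @[n --> \oo] --> t i.
    by rewrite -[X in _ --> X]addr0; apply: cvgD; [exact: cvg_cst|exact: cvg_harmonic].
  exact: (cvg_comp _ _ ch cp).
have cG : FN n u * \prod_(i < p | i != j) w n (tnth u i) @[n --> \oo] -->
    F u * \prod_(i < p | i != j) t i `^ (d - 1).
  apply: cvgM; first exact: FNF.
  apply: cvg_big => [|i _]; last exact: cw.
  by move=> x; exact: mul_continuous.
have cG' : G n u @[n --> \oo] --> (F u * \prod_(i < p | i != j) t i `^ (d - 1))%:E.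
  apply: cvg_EFin; first by near=> n; rewrite /G patchE mem_set//; exact: open_corner_closed.
  rewrite (_ : _ \o _ = fun n => FN n u * \prod_(i < p | i != j) w n (tnth u i))//.
  by apply/funext => n /=; rewrite /G patchE mem_set//; exact: open_corner_closed.
rewrite (cvg_limn_einf_sup cG').1 lee_fin.
have prod0 : 0 <= \prod_(i < p | i != j) t i `^ (d - 1).
  by apply: prodr_ge0 => i _; rewrite powR_ge0.
apply: le_trans (ler_wpM2r prod0 (ltW uF)).
(* The factors t_i^(-d), i != j, turn the weights t_i^(d-1) into 1/t_i, which together with 1/t_j
   make up [logw u]; the remaining factor t_j^(-d) is at least 1. *)
have E : logw u `^ d = (t j)^-1 `^ d * \prod_(i < p | i != j) (t i)^-1 `^ d.
  rewrite /logw powR_prod; last by move=> i _; rewrite invr_ge0 (ltW (t0 i)).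
  by rewrite (bigD1 j).
rewrite E [leLHS](bigD1 j)//= -/(t j) -!mulrA.
apply: ler_wpM2l; first by rewrite invr_ge0 ltW.
rewrite -big_split/=.
rewrite [X in _ <= _ * X](eq_bigr (fun i => (1 - (tnth u i : R))^-1)); last first.
  move=> i _; have ti := t0 i; have tn : t i != 0 by rewrite gt_eqF.
  have -> : (t i)^-1 `^ d = t i `^ (- d).
    by rewrite -(powR_inv1 (ltW ti)) -powRrM mulN1r.
  rewrite -powRD ?tn ?implybT// (_ : - d + (d - 1) = - 1); last by ring.
  by rewrite powR_inv1 ?ltW.
apply: ler_peMl; first by apply: prodr_ge0 => i _; rewrite invr_ge0 ltW// t0.
apply: (@le_trans _ _ (1 `^ d)); first by rewrite powR1.
apply: ge0_ler_powR; rewrite ?nnegrE ?invr_ge0 ?(ltW d0) ?(ltW (t0 _))//.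
by rewrite invf_ge1.
Unshelve. all: by end_near. Qed.

(** A single application of Fatou's lemma to [G] removes both the truncation in [FN] and the shift
    of the weights. *)
Lemma log_measure_exceptional_set :
  (\int[lebesgue_tuple p]_(u in exceptional_set) (logw u)%:E <
     (K * (2 `^ d / d) ^+ p.-1 + 1)%:E)%E.
Proof.
apply: (@le_lt_trans _ _ (K * (2 `^ d / d) ^+ p.-1)%:E); last by rewrite lte_fin ltrDl.
have mE := measurable_exceptional_set.
have sub : exceptional_set `<=` open_corner rho by move=> u [].
apply: (@le_trans _ _ (\int[lebesgue_tuple p]_(u in exceptional_set) limn_einf (G^~ u))%E).
  apply: ge0_le_integral => //.
  - by move=> u /sub h; rewrite lee_fin (logw_ge0 h).
  - apply/measurable_EFinP; 
    exact: (measurable_funS (measurable_open_corner rho) sub (measurable_logw (rho := rho))).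
  - rewrite /limn_einf; apply: measurableT_comp => //.
    apply: measurable_fun_limn_esup => n; apply: measurableT_comp => //.
    exact: (measurable_funS measurableT (@subsetT _ _) (mG n)).
apply: le_trans (fatou _ _ _ _) _ => //.
  by move=> n; exact: (measurable_funS measurableT (@subsetT _ _) (mG n)).
rewrite limn_einf_lim; apply: lime_le.
  exact: is_cvg_einfs.
near=> n.
apply: le_trans (intG n).
apply: (@le_trans _ _ (\int[lebesgue_tuple p]_(u in exceptional_set) G n u)%E).
  by apply: ereal_inf_lbound; exists n => /=.
apply: ge0_subset_integral => //.
Unshelve. all: by end_near. Qed.

End LogMeasureFinite.
(** * Series with nonnegative coefficients outside an exceptional set *)

Section NonnegativeSeries.
Context {R : realType} (p : nat).
Implicit Types (r u : Rtuple R p) (n : multi_index p).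

Lemma ler_sum_subset (T : eqType) (s1 s2 : seq T) (f : T -> R) :
  uniq s1 -> {subset s1 <= s2} -> (forall x, 0 <= f x) ->
  \sum_(x <- s1) f x <= \sum_(x <- s2) f x.
Proof.
move=> + + f0; elim: s1 s2 => [|x s1 IH] s2 /=.
  by move=> _ _; rewrite big_nil sumr_ge0.
move=> /andP[xs1 us1] sub; rewrite big_cons [leRHS](big_rem x)/=; last first.
  by apply: sub; rewrite inE eqxx.
rewrite lerD2l; apply: IH => // y ys1.
have ys2 : y \in s2 by apply: sub; rewrite inE ys1 orbT.
have := perm_to_rem (sub x (mem_head _ _)).
move=> /perm_mem/(_ y); rewrite ys2 inE => /esym/orP[/eqP yx|//].
by move: xs1; rewrite -yx ys1.
Qed.

Definition degree_seq (N : nat) : seq (multi_index p) :=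
  enum_fset (fset_set [set n : multi_index p | (degree n <= N)%N]).

Lemma mem_degree_seq N n : (n \in degree_seq N) = (degree n <= N)%N.
Proof.
by rewrite /degree_seq in_fset_set ?mem_setE//; exact: finite_degree_le.
Qed.

Lemma uniq_degree_seq N : uniq (degree_seq N).
Proof. exact: fset_uniq. Qed.

Lemma sub_degree_seq N M : (N <= M)%N -> {subset degree_seq N <= degree_seq M}.
Proof. by move=> NM n; rewrite !mem_degree_seq => h; exact: leq_trans NM. Qed.

Definition rmonomial n r : R := \prod_(i < p) (tnth r i : R) ^+ n i.

Lemma rmonomial_ge0 n r : (forall i, 0 <= (tnth r i : R)) -> 0 <= rmonomial n r.
Proof. by move=> r0; apply: prodr_ge0 => i _; rewrite exprn_ge0. Qed.

Lemma rmonomial_upd n r j x : rmonomial n (tuple_upd r j x) =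
  (\prod_(i < p | i != j) (tnth r i : R) ^+ n i) * x ^+ n j.
Proof.
rewrite /rmonomial (bigD1 j)//= tnth_mktuple eqxx mulrC; congr (_ * _).
by apply: eq_bigr => i ij; rewrite tnth_mktuple (negbTE ij).
Qed.

Lemma rmonomial_scale n r j c :
  rmonomial n (tuple_upd r j (c * (tnth r j : R))) = c ^+ n j * rmonomial n r.
Proof.
rewrite rmonomial_upd exprMn /rmonomial [in RHS](bigD1 j)//=; ring.
Qed.

Variable b : multi_index p -> R.
Hypothesis b0 : forall n, 0 <= b n.

Definition psum (phi : multi_index p -> R) (N : nat) r : R :=
  \sum_(n <- degree_seq N) phi n * (b n * rmonomial n r).

Lemma psum_ge0 phi N r : (forall n, 0 <= phi n) ->
  (forall i, 0 <= (tnth r i : R)) -> 0 <= psum phi N r.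
Proof.
by move=> f0 r0; apply: sumr_ge0 => n _; rewrite !mulr_ge0// rmonomial_ge0.
Qed.

Lemma psum_nd phi r : (forall n, 0 <= phi n) ->
  (forall i, 0 <= (tnth r i : R)) -> nondecreasing_seq (psum phi ^~ r).
Proof.
move=> f0 r0 N M NM; apply: ler_sum_subset; [exact: uniq_degree_seq|exact: sub_degree_seq|].
by move=> n; rewrite !mulr_ge0// rmonomial_ge0.
Qed.

Lemma measurable_psum (D : set (Rtuple R p)) phi N : measurable_fun D (psum phi N).
Proof.
apply: measurable_funTS; apply: measurable_sum => n; apply: measurable_funM => //.
apply: measurable_funM => //; apply: measurable_prod => i _.
by apply: measurable_funX; exact: measurable_tnth.
Qed.

(* The weights 1, n_j and n_j^2 give the mass and the first two moments of the
   random multi-index n with probability proportional to b_n r^n. *)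
Definition phi0 n : R := 1.
Definition phi1 (j : 'I_p) n : R := (n j)%:R.
Definition phi2 (j : 'I_p) n : R := (n j)%:R * (n j)%:R.

Lemma phi0_ge0 n : 0 <= phi0 n. Proof. exact: ler01. Qed.
Lemma phi1_ge0 j n : 0 <= phi1 j n. Proof. exact: ler0n. Qed.
Lemma phi2_ge0 j n : 0 <= phi2 j n. Proof. by rewrite mulr_ge0. Qed.

Lemma psum_sq_dev j m N r :
  psum (fun n => (phi1 j n - m) ^+ 2) N r =
  psum (phi2 j) N r - 2 * m * psum (phi1 j) N r + m ^+ 2 * psum phi0 N r.
Proof.
rewrite /psum !mulr_sumr -sumrB -big_split/=.
by apply: eq_bigr => n _; rewrite /phi0 /phi1 /phi2; ring.
Qed.

(** Multiplied by the mass, the variance is the sum of the squared deviations from the mean. *)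
Lemma psum_variance_ge0 j N r : (forall i, 0 <= (tnth r i : R)) ->
  0 < psum phi0 N r ->
  0 <= psum (phi2 j) N r / psum phi0 N r -
       (psum (phi1 j) N r / psum phi0 N r) ^+ 2.
Proof.
move=> r0 P0; set m := _ / psum phi0 N r in |- *.
have : 0 <= psum (fun n => (phi1 j n - psum (phi1 j) N r / psum phi0 N r) ^+ 2) N r.
  by apply: psum_ge0 => // n; rewrite sqr_ge0.
rewrite psum_sq_dev => h; rewrite -(pmulr_lge0 _ P0); apply: le_trans h _.
rewrite le_eqVlt; apply/orP; left; apply/eqP; rewrite /m; field.
by rewrite gt_eqF.
Qed.

Section Fibre.
Variables (j : 'I_p) (u : Rtuple R p) (N : nat).

Definition fibre_poly (phi : multi_index p -> R) : {poly R} :=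
  \sum_(n <- degree_seq N)
    (phi n * (b n * \prod_(i < p | i != j) (tnth u i : R) ^+ n i)) *: 'X^(n j).

Lemma horner_fibre_poly phi x :
  (fibre_poly phi).[x] = psum phi N (tuple_upd u j x).
Proof.
rewrite /fibre_poly horner_sum; apply: eq_bigr => n _.
by rewrite hornerZ hornerXn rmonomial_upd !mulrA.
Qed.

(** Euler's operator x d/dx multiplies the coefficient of x^k by k, so applying it to the weight
    [phi0] gives [phi1] and then [phi2]: these are the polynomials H and K of the one-variable
    estimates. *)
Lemma euler_fibre_poly phi :
  'X * (fibre_poly phi)^`() = fibre_poly (fun n => (n j)%:R * phi n).
Proof.
rewrite /fibre_poly raddf_sum mulr_sumr; apply: eq_bigr => n _ /=.
rewrite derivZ derivXn; case: (n j) => [|k].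
  by rewrite mulr0n scaler0 mulr0 !mul0r scale0r.
rewrite -scalerAr mulrnAr -exprS -scaler_nat scalerA; congr (_ *: _).
by rewrite mulrC -!mulrA.
Qed.

End Fibre.

End NonnegativeSeries.

(** * Moments of the random multi-index and their exceptional sets *)

Section ExceptionalSeries.
Context {R : realType} (p : nat).
Local Notation mu := (@lebesgue_measure R).
Implicit Types (r u : Rtuple R p) (n : multi_index p).
Variable b : multi_index p -> R.
Hypothesis b0 : forall n, 0 <= b n.
Hypothesis bsum : forall r, unit_cube r ->
  exists M, forall N, psum b (@phi0 R p) N r <= M.

Lemma cvgn_psum_le (M : R) phi r : (forall n, 0 <= phi n) -> unit_cube r ->
  (forall N, psum b phi N r <= M) -> cvgn (psum b phi ^~ r).
Proof.
move=> f0 r1 hM; have r0 i : 0 <= (tnth r i : R) by have /andP[] := r1 i.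
apply: nondecreasing_is_cvgn; first exact: psum_nd.
by exists M => _ [N _ <-].
Qed.

Lemma cvgn_psum0 r : unit_cube r -> cvgn (psum b (@phi0 R p) ^~ r).
Proof.
by move=> r1; have [M hM] := bsum r1; apply: cvgn_psum_le hM => //; exact: phi0_ge0.
Qed.

Lemma expr_ge_linear (s : R) k : 0 <= s -> k%:R * s <= (1 + s) ^+ k.
Proof.
move=> s0; elim: k => [|k IH]; first by rewrite mul0r expr0.
rewrite exprS mulrDl mul1r -natr1 mulrDl mul1r.
apply: lerD => //; rewrite ler_peMr// exprn_ege1//.
by rewrite lerDl.
Qed.

(** The polydisc is open: enlarging r_j by the factor (1 + s)^2 keeps the series summable, and (1 +
    s)^(2 n_j) >= (n_j s)^2 dominates the weight. *)
Lemma cvgn_psum_coord phi j r : (forall n, 0 <= phi n <= phi2 j n) -> unit_cube r ->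
  cvgn (psum b phi ^~ r).
Proof.
move=> f2 r1.
have f0 n : 0 <= phi n by have /andP[] := f2 n.
have /andP[x0 x1] := r1 j; set x : R := tnth r j in x0 x1.
(* Chosen so that (1 + s)^2 x <= (1 + 3 s) x = (2 - x) x < 1. *)
pose s := (1 - x) / 3.
have s0 : 0 < s by rewrite divr_gt0// subr_gt0.
have s1 : s <= 1 by rewrite /s; lra.
pose r' := tuple_upd r j ((1 + s) ^+ 2 * x).
have r'1 : unit_cube r'.
  move=> i; rewrite tnth_mktuple; case: eqVneq => [_|ij]; last exact: r1.
  rewrite mulr_ge0 ?sqr_ge0//= (@le_lt_trans _ _ ((1 + 3 * s) * x))//.
    by rewrite ler_wpM2r//; nra.
  by rewrite /s; nra.
have [M hM] := bsum r'1.
apply: (@cvgn_psum_le (s^-1 ^+ 2 * M)) => // N.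
apply: (@le_trans _ _ (s^-1 ^+ 2 * psum b (@phi0 R p) N r')); last first.
  by rewrite ler_wpM2l// sqr_ge0.
rewrite /psum mulr_sumr; apply: ler_sum => n _.
rewrite /phi0 mul1r rmonomial_scale.
have m0 : 0 <= rmonomial n r.
  by apply: rmonomial_ge0 => i; have /andP[] := r1 i.
rewrite (mulrCA (b n)) [leRHS]mulrA; apply: ler_wpM2r; first by rewrite mulr_ge0.
have /andP[_ h] := f2 n; apply: le_trans h _.
rewrite /phi2 -exprM mulnC exprM -exprMn -expr2 lerXn2r// ?nnegrE//.
  by rewrite mulr_ge0 ?invr_ge0 ?exprn_ge0 ?addr_ge0// ltW.
by rewrite mulrC ler_pdivlMr// expr_ge_linear// ltW.
Qed.

Definition mass r : R := limn (psum b (@phi0 R p) ^~ r).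
Definition moment1 j r : R := limn (psum b (@phi1 R p j) ^~ r).
Definition moment2 j r : R := limn (psum b (@phi2 R p j) ^~ r).

Definition smean j r : R := moment1 j r / mass r.
Definition svar j r : R := moment2 j r / mass r - smean j r ^+ 2.

Lemma cvg_mass r : unit_cube r -> psum b (@phi0 R p) N r @[N --> \oo] --> mass r.
Proof. exact: cvgn_psum0. Qed.

Lemma cvg_moment1 j r : unit_cube r -> psum b (@phi1 R p j) N r @[N --> \oo] --> moment1 j r.
Proof.
apply: (@cvgn_psum_coord _ j) => n; rewrite phi1_ge0 /phi1 /phi2/= -natrM ler_nat.
by case: (n j) => // k; rewrite leq_pmulr.
Qed.

Lemma cvg_moment2 j r : unit_cube r -> psum b (@phi2 R p j) N r @[N --> \oo] --> moment2 j r.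
Proof. by apply: (@cvgn_psum_coord _ j) => n; rewrite phi2_ge0 lexx. Qed.

Variables (n0 : multi_index p) (rho d : R).
Hypotheses (bn0 : 0 < b n0) (rho0 : 0 < rho) (rho1 : rho < 1) (d0 : 0 < d).

(* Lower bound for the mass on the corner, used to normalize its logarithm. *)
Definition low_term : R := b n0 * rho ^+ degree n0.

Lemma low_term_gt0 : 0 < low_term. Proof. by rewrite mulr_gt0// exprn_gt0. Qed.

Lemma closed_corner_ge0 r i : closed_corner rho r -> 0 <= (tnth r i : R).
Proof. by move=> /(_ i)/andP[+ _]; apply: le_trans; exact: ltW. Qed.

Lemma open_corner_cube r : open_corner rho r -> unit_cube r.
Proof. by move=> h i; have /andP[h1 ->] := h i; rewrite (le_trans (ltW rho0) h1). Qed.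

Lemma rmonomial_ge r : closed_corner rho r -> rho ^+ degree n0 <= rmonomial n0 r.
Proof.
move=> rC; rewrite /degree -prodrXr; apply: ler_prod => i _.
rewrite exprn_ge0 ?(ltW rho0)//= lerXn2r ?nnegrE ?(ltW rho0) ?(closed_corner_ge0 i rC)//.
by have /andP[] := rC i.
Qed.

Lemma psum0_ge_term N n r : (degree n <= N)%N -> (forall i, 0 <= (tnth r i : R)) ->
  b n * rmonomial n r <= psum b (@phi0 R p) N r.
Proof.
move=> nN r0.
have := @ler_sum_subset R _ [:: n] (degree_seq p N) (fun n => @phi0 R p n * (b n * rmonomial n r)).
rewrite big_seq1 /phi0 mul1r; apply => //.
  by move=> m; rewrite inE => /eqP ->; rewrite mem_degree_seq.
by move=> m; rewrite mul1r mulr_ge0// rmonomial_ge0.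
Qed.

Lemma low_term_le N r : (degree n0 <= N)%N -> closed_corner rho r ->
  low_term <= psum b (@phi0 R p) N r.
Proof.
move=> nN rC; apply: le_trans (psum0_ge_term nN (fun i => closed_corner_ge0 i rC)).
by rewrite /low_term ler_wpM2l// rmonomial_ge.
Qed.

Lemma low_term_le_mass r : open_corner rho r -> low_term <= mass r.
Proof.
move=> rC; have rU := open_corner_cube rC.
have r0 i : 0 <= (tnth r i : R) by have /andP[] := rU i.
have h := nondecreasing_cvgn_le (psum_nd b0 (@phi0_ge0 R p) r0) (cvgn_psum0 rU).
apply: le_trans (h (degree n0)).
by apply: low_term_le => //; exact: open_corner_closed.
Qed.

Definition sgrowth r : R := 1 + ln (mass r / low_term).

Definition mean_set (j : 'I_p) : set (Rtuple R p) :=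
  exceptional_set j rho d (fun r => smean j r / sgrowth r `^ (1 + d)).

Definition variance_set (j : 'I_p) : set (Rtuple R p) :=
  exceptional_set j rho d (fun r => svar j r / (1 + smean j r) `^ (1 + d)).

(** The shift puts the term n0 into every partial sum considered, so that all of them are at least
    [low_term] on the closed corner, including the first ones. *)
Let S N := (degree n0 + N)%N.

Let cvgS phi (l : R) r : psum b phi N r @[N --> \oo] --> l ->
  psum b phi (S N) r @[N --> \oo] --> l.
Proof.
move=> h; rewrite (_ : (fun N => _) = [sequence (psum b phi ^~ r) (n + degree n0)%N]_n).
  by have e := cvg_shiftn (degree n0) (psum b phi ^~ r) (nbhs l); rewrite -e in h.
by apply/funext => N /=; rewrite /S addnC.
Qed.

Let SG N r : closed_corner rho r -> low_term <= psum b (@phi0 R p) (S N) r.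
Proof. by apply: low_term_le; rewrite leq_addr. Qed.

Let SG0 N r : closed_corner rho r -> 0 < psum b (@phi0 R p) (S N) r.
Proof. by move=> rC; apply: lt_le_trans (SG N rC); exact: low_term_gt0. Qed.

Let mN j N r := psum b (@phi1 R p j) (S N) r / psum b (@phi0 R p) (S N) r.
Let vN j N r := psum b (@phi2 R p j) (S N) r / psum b (@phi0 R p) (S N) r - mN j N r ^+ 2.

Let mN0 j N r : closed_corner rho r -> 0 <= mN j N r.
Proof.
move=> rC; rewrite divr_ge0 ?(ltW (SG0 _ rC))//; apply: psum_ge0 => // i.
exact: closed_corner_ge0 rC.
Qed.

Let mmN j N : measurable_fun (closed_corner rho) (mN j N).
Proof.
apply: measurable_funM; first exact: measurable_psum.
apply: measurable_funV_ge0; first exact: measurable_psum.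
by move=> r rC; rewrite ltW// SG0.
Qed.

Let mvN j N : measurable_fun (closed_corner rho) (vN j N).
Proof.
apply: measurable_funB; last by apply: measurable_funX; exact: mmN.
apply: measurable_funM; first exact: measurable_psum.
apply: measurable_funV_ge0; first exact: measurable_psum.
by move=> r rC; rewrite ltW// SG0.
Qed.

Let cmN j r : open_corner rho r -> mN j N r @[N --> \oo] --> smean j r.
Proof.
move=> ro; have rU := open_corner_cube ro.
apply: cvgM; first by apply: cvgS; exact: cvg_moment1.
apply: cvgV; first by rewrite gt_eqF// (lt_le_trans low_term_gt0)// low_term_le_mass.
by apply: cvgS; exact: cvg_mass.
Qed.

Let cvN j r : open_corner rho r -> vN j N r @[N --> \oo] --> svar j r.
Proof.
move=> ro; have rU := open_corner_cube ro.
apply: cvgB; last by apply: cvgM; exact: cmN.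
apply: cvgM; first by apply: cvgS; exact: cvg_moment2.
apply: cvgV; first by rewrite gt_eqF// (lt_le_trans low_term_gt0)// low_term_le_mass.
by apply: cvgS; exact: cvg_mass.
Qed.

Lemma smean_ge0 j r : open_corner rho r -> 0 <= smean j r.
Proof.
move=> ro; rewrite -(cvg_lim _ (cmN (j := j) ro))//; apply: limr_ge.
  by apply/cvg_ex; exists (smean j r); exact: cmN.
by near=> N; apply: mN0; exact: open_corner_closed.
Unshelve. all: by end_near. Qed.

Let powcvg (f : nat -> R) (l e : R) : f n @[n --> \oo] --> l -> 0 < l ->
  (f n `^ e) @[n --> \oo] --> l `^ e.
Proof.
move=> cf l0; have cp : {for l, continuous (fun z : R => z `^ e)}.
  by apply: cvg_powR_comp => //; exact: cvg_id.
exact: (cvg_comp _ _ cf cp).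
Qed.

Let updC r j x : closed_corner rho r -> x \in `[rho, 1] ->
  closed_corner rho (tuple_upd r j x).
Proof.
move=> rC; rewrite in_itv/= => xr i; rewrite tnth_mktuple.
by case: eqVneq => // _; exact: rC.
Qed.

Let euler1 j u N : fibre_poly b j u N (@phi1 R p j) =
  'X * (fibre_poly b j u N (@phi0 R p))^`().
Proof.
rewrite euler_fibre_poly; congr fibre_poly; apply/funext => n.
by rewrite /phi1 /phi0 mulr1.
Qed.

Let euler2 j u N : fibre_poly b j u N (@phi2 R p j) =
  'X * ('X * (fibre_poly b j u N (@phi0 R p))^`())^`().
Proof. by rewrite -euler1 euler_fibre_poly. Qed.

(** Along a fibre in direction j the approximant is the integrand of [fibre_mean] for the polynomial
    [fibre_poly]; this gives the constant K = 1/d, uniform in N and in the fibre. *)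
Lemma mean_set_log_measure j : measurable (mean_set j) /\
  (\int[lebesgue_tuple p]_(u in mean_set j) (logw u)%:E < +oo)%E.
Proof.
pose FN N r := mN j N r / (1 + ln (psum b (@phi0 R p) (S N) r / low_term)) `^ (1 + d).
have mFN N : measurable_fun (closed_corner rho) (FN N).
  apply: measurable_funM; first exact: mmN.
  apply: measurable_funV_ge0; last by move=> r _; exact: powR_ge0.
  apply: (@measurableT_comp _ _ _ _ _ _ (@powR R ^~ (1 + d))); first exact: measurable_powR.
  apply: measurable_funD => //.
  apply: (@measurableT_comp _ _ _ _ _ _ (@ln R)); first exact: measurable_ln.
  apply: measurable_funM => //.
  exact: measurable_psum.
have FN0 N r : closed_corner rho r -> 0 <= FN N r.
  by move=> rC; rewrite divr_ge0 ?powR_ge0// mN0.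
have FNF r : open_corner rho r ->
    FN N r @[N --> \oo] --> smean j r / sgrowth r `^ (1 + d).
  move=> ro; have rU := open_corner_cube ro.
  have gl : 0 < mass r / low_term.
    by rewrite divr_gt0 ?low_term_gt0// (lt_le_trans low_term_gt0)// low_term_le_mass.
  have g1 : 0 < sgrowth r.
    rewrite /sgrowth ltr_pwDl// ln_ge0// ler_pdivlMr ?low_term_gt0//.
    by rewrite mul1r low_term_le_mass.
  apply: cvgM; first exact: cmN.
  apply: cvgV; first by rewrite gt_eqF// powR_gt0.
  apply: powcvg => //; apply: cvgD; first exact: cvg_cst.
  have cq : psum b (@phi0 R p) (S N) r / low_term @[N --> \oo] --> mass r / low_term.
    by apply: cvgM; [apply: cvgS; exact: cvg_mass|exact: cvg_cst].
  exact: (cvg_comp _ _ cq (continuous_ln gl)).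
have fib N u : closed_corner rho u ->
    (\int[mu]_(x in `[rho, 1%R]) (FN N (tuple_upd u j x))%:E <= (d^-1)%:E)%E.
  move=> uC.
  have := @fibre_mean R (fibre_poly b j u (S N) (@phi0 R p)) low_term rho d
    low_term_gt0 rho0 rho1 d0.
  rewrite -euler1 => h.
  apply: le_trans (h _ _).
  - rewrite le_eqVlt; apply/orP; left; apply/eqP; apply: eq_integral => x _.
    by rewrite !horner_fibre_poly.
  - by move=> x xr; rewrite horner_fibre_poly SG//; apply: updC => //; rewrite in_itv.
  - move=> x xr; rewrite horner_fibre_poly; apply: psum_ge0 => // i.
    by apply: closed_corner_ge0; apply: updC => //; rewrite in_itv.
have di : 0 <= d^-1 by rewrite invr_ge0 ltW.
split; first exact: measurable_exceptional_set mFN FNF.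
exact: lt_trans (log_measure_exceptional_set rho0 rho1 d0 di mFN FN0 FNF fib) (ltry _).
Qed.

Lemma variance_set_log_measure j : measurable (variance_set j) /\
  (\int[lebesgue_tuple p]_(u in variance_set j) (logw u)%:E < +oo)%E.
Proof.
pose FN N r := vN j N r / (1 + mN j N r) `^ (1 + d).
have mFN N : measurable_fun (closed_corner rho) (FN N).
  apply: measurable_funM; first exact: mvN.
  apply: measurable_funV_ge0; last by move=> r _; exact: powR_ge0.
  apply: (@measurableT_comp _ _ _ _ _ _ (@powR R ^~ (1 + d))); first exact: measurable_powR.
  by apply: measurable_funD => //; exact: mmN.
have vN0 N r : closed_corner rho r -> 0 <= vN j N r.
  move=> rC; apply: psum_variance_ge0 => //; last exact: SG0.
  by move=> i; exact: closed_corner_ge0 rC.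
have FN0 N r : closed_corner rho r -> 0 <= FN N r.
  by move=> rC; rewrite divr_ge0 ?powR_ge0// vN0.
have FNF r : open_corner rho r ->
    FN N r @[N --> \oo] --> svar j r / (1 + smean j r) `^ (1 + d).
  move=> ro.
  have m1 : 0 < 1 + smean j r by rewrite ltr_pwDl// smean_ge0.
  apply: cvgM; first exact: cvN.
  apply: cvgV; first by rewrite gt_eqF// powR_gt0.
  by apply: powcvg => //; apply: cvgD; [exact: cvg_cst|exact: cmN].
have fib N u : closed_corner rho u ->
    (\int[mu]_(x in `[rho, 1%R]) (FN N (tuple_upd u j x))%:E <= (d^-1)%:E)%E.
  move=> uC.
  have := @fibre_variance R (fibre_poly b j u (S N) (@phi0 R p)) low_term rho d
    low_term_gt0 rho0 rho1 d0.
  rewrite -euler2 -euler1 => h.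
  apply: le_trans (h _ _ _).
  - rewrite le_eqVlt; apply/orP; left; apply/eqP; apply: eq_integral => x _.
    by rewrite !horner_fibre_poly.
  - by move=> x xr; rewrite horner_fibre_poly SG//; apply: updC => //; rewrite in_itv.
  - move=> x xr; rewrite horner_fibre_poly; apply: psum_ge0 => // i.
    by apply: closed_corner_ge0; apply: updC => //; rewrite in_itv.
  - move=> x xr; rewrite !horner_fibre_poly; apply: vN0.
    by apply: updC => //; rewrite in_itv.
have di : 0 <= d^-1 by rewrite invr_ge0 ltW.
split; first exact: measurable_exceptional_set mFN FNF.
exact: lt_trans (log_measure_exceptional_set rho0 rho1 d0 di mFN FN0 FNF fib) (ltry _).
Qed.

End ExceptionalSeries.

(** * Chebyshev's inequality and the number of dominant terms *)

Section Chebyshev.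
Context {R : realType} (p : nat).
Implicit Types (r u : Rtuple R p) (n : multi_index p).

Lemma count_nat_interval (x y : R) N : x <= y ->
  \sum_(k < N) (x < (k%:R : R) < y)%R%:R <= y - x + 1.
Proof.
move=> xy.
(* The bound N - x drives the induction: when N itself is counted, N < y turns it into the bound
   wanted. The empty count is a separate case since N - x may be negative. *)
suff [->|[]//] : \sum_(k < N) (x < (k%:R : R) < y)%R%:R = 0 :> R \/
   (\sum_(k < N) (x < (k%:R : R) < y)%R%:R <= y - x + 1 /\
    \sum_(k < N) (x < (k%:R : R) < y)%R%:R <= N%:R - x).
  by rewrite addr_ge0// subr_ge0.
elim: N => [|N IH]; first by left; rewrite big_ord0.
rewrite big_ord_recr/=; case: (boolP (x < N%:R < y)) => [/andP[xN Ny]|_].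
  right; rewrite -natr1 /=; case: IH => [->|[h1 h2]]; split; lra.
rewrite addr0; case: IH => [->|[h1 h2]]; [by left|right; split => //].
by rewrite -natr1; lra.
Qed.

(** The simplex of degree at most N lies in the cube {0, ..., N}^p, over which the sum of products
    factorizes. *)
Lemma sum_degree_seq_prod_le (N : nat) (F : 'I_p -> nat -> R) : (forall j k, 0 <= F j k) ->
  \sum_(n <- degree_seq p N) \prod_(j < p) F j (n j) <=
  \prod_(j < p) \sum_(k < N.+1) F j k.
Proof.
move=> F0; rewrite bigA_distr_bigA/=.
pose s2 := map (fun f : {ffun 'I_p -> 'I_N.+1} =>
  ([ffun j => val (f j)] : multi_index p)) (enum {ffun 'I_p -> 'I_N.+1}).
have -> : \sum_(f : {ffun 'I_p -> 'I_N.+1}) \prod_(j < p) F j (f j) =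
   \sum_(n <- s2) \prod_(j < p) F j (n j).
  rewrite /s2 big_map big_enum/=; apply: eq_bigr => f _.
  by apply: eq_bigr => j _; rewrite ffunE.
apply: ler_sum_subset; first exact: uniq_degree_seq.
  move=> n; rewrite mem_degree_seq => nN.
  apply/mapP; exists [ffun j => inord (n j)]; first by rewrite mem_enum.
  apply/ffunP => j; rewrite !ffunE /= inordK// ltnS (leq_trans _ nN)//.
  by rewrite /degree (bigD1 j)//= leq_addr.
by move=> n; exact: prodr_ge0.
Qed.

Variable b : multi_index p -> R.
Hypothesis b0 : forall n, 0 <= b n.
Hypothesis bsum : forall r, unit_cube r ->
  exists M, forall N, psum b (@phi0 R p) N r <= M.

Section Point.
Variable r : Rtuple R p.
Hypothesis r1 : unit_cube r.
Hypothesis G0r : 0 < mass b r.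

Let r0 i : 0 <= (tnth r i : R). Proof. by have /andP[] := r1 i. Qed.

Lemma psum_le_mass N : psum b (@phi0 R p) N r <= mass b r.
Proof.
exact: (nondecreasing_cvgn_le (psum_nd b0 (@phi0_ge0 R p) r0) (cvgn_psum0 b0 bsum r1)).
Qed.

Lemma psum_le_moment1 j N : psum b (@phi1 R p j) N r <= moment1 b j r.
Proof.
apply: (nondecreasing_cvgn_le (psum_nd b0 (@phi1_ge0 R p j) r0)).
by apply/cvg_ex; exists (moment1 b j r); exact: cvg_moment1.
Qed.

Lemma psum_dev_le j N :
  psum b (fun n => (phi1 j n - smean b j r) ^+ 2) N r <= svar b j r * mass b r.
Proof.
have c : psum b (fun n => (phi1 j n - smean b j r) ^+ 2) N r @[N --> \oo] -->
    svar b j r * mass b r.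
  under eq_fun do rewrite psum_sq_dev.
  have -> : svar b j r * mass b r =
      moment2 b j r - 2 * smean b j r * moment1 b j r + smean b j r ^+ 2 * mass b r.
    by rewrite /svar /smean; field; rewrite gt_eqF.
  apply: cvgD; last by apply: cvgMr; exact: cvg_mass.
  apply: cvgB; first exact: cvg_moment2.
  by apply: cvgMr; exact: cvg_moment1.
rewrite -(cvg_lim _ c)//; apply: nondecreasing_cvgn_le; last first.
  by apply/cvg_ex; eexists; exact: c.
by apply: psum_nd => // n; rewrite sqr_ge0.
Qed.

Lemma chebyshev_bound (M : R) (V : 'I_p -> R) : (0 < p)%N ->
  (forall n, b n * rmonomial n r <= M) -> (forall j, 0 < V j) ->
  (forall j, svar b j r <= V j) ->
  mass b r <= 2 * M * \prod_(j < p) (2 * Num.sqrt (2 * p%:R * V j) + 1).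
Proof.
move=> p0 bM V0 sV.
have pR : 0 < p%:R :> R by rewrite ltr0n.
have M0 : 0 <= M.
  by apply: le_trans (bM [ffun=> 0%N]); rewrite mulr_ge0// rmonomial_ge0.
(* With this half-width a coordinate leaves its window with probability at most V_j / h_j^2 =
   1/(2p), hence some coordinate does with probability at most 1/2. *)
pose h j := Num.sqrt (2 * p%:R * V j).
have h0 j : 0 < h j by rewrite sqrtr_gt0 !mulr_gt0.
have h2 j : h j ^+ 2 = 2 * p%:R * V j by rewrite sqr_sqrtr// !mulr_ge0// ltW.
pose m j := smean b j r.
pose near j (k : nat) : R := ((m j - h j < k%:R < m j + h j)%R : bool)%:R.
have step N : psum b (@phi0 R p) N r <=
    M * \prod_(j < p) (2 * h j + 1) + mass b r / 2.
  (* Term by term: inside the box the term is at most M; outside, some squared deviation divided by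
     h_j^2 is at least 1. *)
  apply: (@le_trans _ _ (\sum_(n <- degree_seq p N) (M * \prod_(j < p) near j (n j) +
     \sum_(j < p) (h j ^+ 2)^-1 * ((phi1 j n - m j) ^+ 2 * (b n * rmonomial n r))))).
    apply: ler_sum => n _; rewrite /phi0 mul1r.
    have t0 : 0 <= b n * rmonomial n r by rewrite mulr_ge0// rmonomial_ge0.
    have s0 j : 0 <= (h j ^+ 2)^-1 * ((phi1 j n - m j) ^+ 2 * (b n * rmonomial n r)).
      by rewrite mulr_ge0 ?invr_ge0 ?sqr_ge0// mulr_ge0// sqr_ge0.
    case: (boolP [forall j : 'I_p, m j - h j < (n j)%:R < m j + h j]) => [/forallP a|].
      rewrite big1 ?mulr1; last by move=> j _; rewrite /near a.
      by rewrite -[leLHS]addr0 lerD// sumr_ge0.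
    rewrite negb_forall => /existsP[j nj].
    have -> : \prod_(j < p) near j (n j) = 0.
      by rewrite (bigD1 j)//= /near (negbTE nj) mul0r.
    rewrite mulr0 add0r (bigD1 j)//= -[leLHS]addr0 lerD ?sumr_ge0//.
    rewrite [leRHS]mulrA -[leLHS]mul1r ler_wpM2r//.
    rewrite mulrC ler_pdivlMr ?exprn_gt0// mul1r.
    have a1 : h j <= `|phi1 j n - m j|.
      rewrite real_ler_normr ?num_real//; move: nj.
      by rewrite negb_and -!leNgt => /orP[]; rewrite /phi1 => nj; apply/orP; [right|left]; lra.
    rewrite -[leRHS]real_normK ?num_real// lerXn2r ?nnegrE ?(ltW (h0 j))//.
  rewrite big_split/= lerD//.
    rewrite -mulr_sumr ler_wpM2l//.
    apply: le_trans (@sum_degree_seq_prod_le N near _) _; first by move=> j k; rewrite ler0n.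
    apply: ler_prod => j _; rewrite sumr_ge0//=.
    apply: le_trans (@count_nat_interval (m j - h j) (m j + h j) N.+1 _) _.
      by have := h0 j; lra.
    lra.
  rewrite exchange_big/=.
  apply: (@le_trans _ _ (\sum_(j < p) mass b r / (2 * p%:R))).
    apply: ler_sum => j _; rewrite -mulr_sumr.
    have := psum_dev_le j N; rewrite /psum -/(m j) => hd.
    apply: (@le_trans _ _ ((h j ^+ 2)^-1 * (V j * mass b r))).
      rewrite ler_wpM2l ?invr_ge0 ?sqr_ge0// (le_trans hd)//.
      by rewrite ler_wpM2r// ltW.
    rewrite h2 le_eqVlt; apply/orP; left; apply/eqP; field.
    by rewrite !gt_eqF.
  rewrite sumr_const card_ord -mulr_natr le_eqVlt; apply/orP; left; apply/eqP.
  by field; rewrite gt_eqF.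
have lim : mass b r <= M * \prod_(j < p) (2 * h j + 1) + mass b r / 2.
  rewrite {1}/mass; apply: limr_le; first exact: cvgn_psum0.
  by near=> N; exact: step.
rewrite -mulrA -/(h _); move: lim; set X := M * _; lra.
Unshelve. all: by end_near. Qed.

(** Markov's inequality for the total degree, whose mean is the sum of the coordinate means. *)
Lemma tail_le N N' : psum b (fun n => (N < degree n)%N%:R) N' r * N%:R <=
  \sum_(j < p) moment1 b j r.
Proof.
apply: (@le_trans _ _ (\sum_(j < p) psum b (@phi1 R p j) N' r)); last first.
  by apply: ler_sum => j _; exact: psum_le_moment1.
rewrite /psum exchange_big/= mulr_suml; apply: ler_sum => n _.
have t0 : 0 <= b n * rmonomial n r by rewrite mulr_ge0// rmonomial_ge0.
rewrite -mulr_suml mulrAC ler_wpM2r//.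
rewrite /phi1 -natr_sum -/(degree n) -natrM ler_nat.
by case: ltnP => [/ltnW|_]; rewrite ?mul1n ?mul0n.
Qed.

End Point.
End Chebyshev.

(** * Growth of the sum of absolute values outside the exceptional sets *)

Section Growth.
Context {R : realType} (p : nat).
Implicit Types (r u : Rtuple R p) (n : multi_index p).
Variable b : multi_index p -> R.
Hypothesis b0 : forall n, 0 <= b n.
Hypothesis bsum : forall r, unit_cube r ->
  exists M, forall N, psum b (@phi0 R p) N r <= M.
Variables (n0 : multi_index p) (rho : R).
Hypotheses (bn0 : 0 < b n0) (rho0 : 0 < rho) (rho1 : rho < 1) (p0 : (0 < p)%N).

Lemma inv_sub_ge1 r j : open_corner rho r -> 1 <= (1 - (tnth r j : R))^-1.
Proof.
move=> ro; rewrite invf_ge1 ?(open_corner_gt0 _ ro)//.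
by have /andP[h _] := ro j; rewrite lerBlDr lerDl (le_trans (ltW rho0)).
Qed.

Lemma logw_ge1 r : open_corner rho r -> 1 <= logw r.
Proof.
move=> ro; apply: (@le_trans _ _ (\prod_(i < p) (1 : R))); first by rewrite big1_eq.
by apply: ler_prod => j _; rewrite ler01/= inv_sub_ge1.
Qed.

Lemma inv_sub_le_logw r j : open_corner rho r -> (1 - (tnth r j : R))^-1 <= logw r.
Proof.
move=> ro; rewrite /logw (bigD1 j)//= ler_peMr//.
  by rewrite (le_trans ler01)// inv_sub_ge1.
apply: (@le_trans _ _ (\prod_(i < p | i != j) (1 : R))); first by rewrite big1_eq.
by apply: ler_prod => i _; rewrite ler01/= inv_sub_ge1.
Qed.

Lemma exponent_bounds (d : R) : 0 < d -> d <= 1 ->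
  [/\ 1 + d <= 2, (1 + d) * (1 + d) <= 1 + 3 * d & d * (1 + d) <= 2 * d].
Proof. by move=> d0 d1; split; nra. Qed.

Section Pointwise.
Variables (d : R) (r : Rtuple R p) (M : R).
Hypotheses (d0 : 0 < d) (d1 : d <= 1) (ro : open_corner rho r).
Hypothesis rmean : forall j, ~ mean_set b n0 rho d j r.
Hypothesis rvar : forall j, ~ variance_set b rho d j r.
Hypothesis bM : forall n, b n * rmonomial n r <= M.

Let W := logw r.
Let g := sgrowth b n0 rho r.
Let t j := (1 - (tnth r j : R))^-1.

Lemma mass_gt0 : 0 < mass b r.
Proof.
by apply: lt_le_trans (low_term_gt0 bn0 rho0) _; exact: low_term_le_mass.
Qed.

Lemma sgrowth_ge1 : 1 <= g.
Proof.
rewrite /g /sgrowth lerDl ln_ge0// ler_pdivlMr ?low_term_gt0//.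
by rewrite mul1r low_term_le_mass.
Qed.

Let W1 : 1 <= W. Proof. exact: logw_ge1. Qed.
Let t1 j : 1 <= t j. Proof. exact: inv_sub_ge1. Qed.
Let tW j : t j <= W. Proof. exact: inv_sub_le_logw. Qed.
Let W0 : 0 < W. Proof. exact: lt_le_trans W1. Qed.
Let t0 j : 0 < t j. Proof. exact: lt_le_trans (t1 j). Qed.
Let g1 : 1 <= g := sgrowth_ge1.
Let g0 : 0 < g. Proof. exact: lt_le_trans g1. Qed.

Let pow_ge1 (x e : R) : 1 <= x -> 0 <= e -> 1 <= x `^ e.
Proof. by move=> x1 e0; rewrite -(powRr0 x) ler_powR. Qed.

Let smean_pow j : smean b j r <= t j * g `^ (1 + d) * W `^ d.
Proof.
have := rmean (j := j); rewrite /mean_set /exceptional_set/= => h.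
have : ~~ ((1 - (tnth r j : R))^-1 * logw r `^ d <
    smean b j r / sgrowth b n0 rho r `^ (1 + d)).
  by apply/negP => h'; exact: h.
rewrite -leNgt ler_pdivrMr; last by rewrite powR_gt0.
by rewrite mulrAC.
Qed.

(** Crude on purpose: it only serves to bound the tail of the series, where a larger truncation
    degree makes up for any fixed power. *)
Lemma smean_le j : smean b j r <= W ^+ 2 * g ^+ 2.
Proof.
apply: le_trans (smean_pow j) _.
have hg : g `^ (1 + d) <= g ^+ 2.
  by rewrite -powR_mulrn ?(ltW g0)// ler_powR// lerD.
have hW : W `^ d <= W by rewrite -[leRHS]powRr1 ?(ltW W0)// ler_powR.
rewrite mulrAC expr2 ler_pM ?mulr_ge0 ?powR_ge0 ?(ltW (t0 j))//.
by rewrite ler_pM ?powR_ge0 ?(ltW (t0 j))//; exact: tW.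
Qed.

(** Bound for the standard deviation. The variance carries one factor t_j of its own and one from
    the mean inside (1 + m_j)^(1+d), so its square root carries just one, and the product over j
    gives a single W, up to the small powers. *)
Let Y j := 2 * t j * g `^ ((1 + 3 * d) / 2) * W `^ (2 * d).

Let Y0 j : 0 < Y j. Proof. by rewrite !mulr_gt0 ?powR_gt0. Qed.

Let svar_pow j : svar b j r <= Y j ^+ 2.
Proof.
have h : svar b j r <= t j * W `^ d * (1 + smean b j r) `^ (1 + d).
  have := rvar (j := j); rewrite /variance_set /exceptional_set/= => h.
  have : ~~ ((1 - (tnth r j : R))^-1 * logw r `^ d <
      svar b j r / (1 + smean b j r) `^ (1 + d)).
    by apply/negP => h'; exact: h.
  rewrite -leNgt ler_pdivrMr// powR_gt0//.
  by rewrite ltr_pwDl//; exact: (smean_ge0 b0 bsum bn0 rho0 j ro).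
apply: le_trans h _.
set X := t j * g `^ (1 + d) * W `^ d.
have X1 : 1 <= X.
  have gp : 1 <= g `^ (1 + d) by apply: pow_ge1 => //; rewrite addr_ge0// ltW.
  have Wp : 1 <= W `^ d by apply: pow_ge1 => //; exact: ltW.
  rewrite /X mulr_ege1// mulr_ege1//; exact: t1.
have mX : 1 + smean b j r <= 2 * X.
  by have := smean_pow j; rewrite -/X => ?; lra.
have m0 : 0 <= smean b j r := smean_ge0 b0 bsum bn0 rho0 j ro.
have d10 : 0 <= 1 + d by rewrite addr_ge0// ltW.
have h1 : (1 + smean b j r) `^ (1 + d) <= (2 * X) `^ (1 + d).
  by apply: ge0_ler_powR; rewrite ?nnegrE//; lra.
have h2 : (2 * X) `^ (1 + d) <= 4 * (t j * W `^ d * g `^ (1 + 3 * d) * W `^ (2 * d)).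
  rewrite /X !powRM ?mulr_ge0 ?powR_ge0 ?(ltW (t0 j))//.
  apply: ler_pM; rewrite ?mulr_ge0 ?powR_ge0//.
    rewrite (_ : 4 = 2 `^ 2%:R) ?ler_powR//; first by rewrite ler1n.
      by have [] := exponent_bounds d0 d1.
    by rewrite powR_mulrn//; ring.
  rewrite -!powRrM.
  apply: ler_pM; rewrite ?mulr_ge0 ?powR_ge0//; last first.
    by rewrite ler_powR//; have [] := exponent_bounds d0 d1.
  apply: ler_pM; rewrite ?mulr_ge0 ?powR_ge0//; last first.
    by rewrite ler_powR//; have [] := exponent_bounds d0 d1.
  (* The excess power t_j^d is traded for W^d. *)
  rewrite powRD; last by rewrite (gt_eqF (t0 j)) implybT.
  rewrite powRr1 ?(ltW (t0 j))// ler_wpM2l ?(ltW (t0 j))//.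
  by apply: ge0_ler_powR; rewrite ?nnegrE ?(ltW d0) ?(ltW (t0 j)) ?(ltW W0)//; exact: tW.
apply: le_trans (ler_wpM2l _ (le_trans h1 h2)) _.
  by rewrite mulr_ge0 ?powR_ge0// ltW.
rewrite le_eqVlt; apply/orP; left; apply/eqP; rewrite /Y.
have eg : g `^ ((1 + 3 * d) / 2) ^+ 2 = g `^ (1 + 3 * d).
  by rewrite -powR_mulrn ?powR_ge0// -powRrM; congr (_ `^ _); field.
have eW : W `^ (2 * d) = W `^ d ^+ 2.
  by rewrite -powR_mulrn ?powR_ge0// -powRrM; congr (_ `^ _); ring.
rewrite !exprMn eg eW; ring.
Qed.

(** The window length 2 sqrt (2 p Y_j^2) equals 4 sqrt (2p) times Y_j / 2; since Y_j / 2 >= 1, the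
    additional 1 in the count of lattice points is absorbed too. *)
Let C1 : R := 4 * Num.sqrt (2 * p%:R) + 1.

Lemma mass_le_sgrowth : mass b r <=
  2 * C1 ^+ p * M * W * (g `^ ((1 + 3 * d) / 2) * W `^ (2 * d)) ^+ p.
Proof.
have rU := open_corner_cube rho0 ro.
have := chebyshev_bound b0 bsum rU mass_gt0 p0 bM (V := fun j => Y j ^+ 2)
  (fun j => exprn_gt0 _ (Y0 j)) svar_pow.
have M0 : 0 <= M.
  apply: le_trans (bM n0); rewrite mulr_ge0// rmonomial_ge0// => i.
  by have /andP[] := rU i.
move=> h; apply: le_trans h _.
pose Z := g `^ ((1 + 3 * d) / 2) * W `^ (2 * d).
have Z1 : 1 <= Z.
  rewrite /Z mulr_ege1// pow_ge1// ?mulr_ge0 ?invr_ge0 ?addr_ge0 ?mulr_ge0 ?(ltW d0)//.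
have st j : 2 * Num.sqrt (2 * p%:R * Y j ^+ 2) + 1 <= C1 * (t j * Z).
  rewrite sqrtrM ?mulr_ge0// sqrtr_sqr gtr0_norm// /C1 [leRHS]mulrDl [1 * _]mul1r.
  have -> : Y j = 2 * (t j * Z) by rewrite /Y /Z; ring.
  apply: lerD; last by rewrite mulr_ege1//; exact: t1.
  by rewrite le_eqVlt; apply/orP; left; apply/eqP; ring.
apply: (@le_trans _ _ (2 * M * \prod_(j < p) (C1 * (t j * Z)))).
  apply: ler_wpM2l; first by rewrite mulr_ge0.
  by apply: ler_prod => j _; rewrite st addr_ge0// mulr_ge0// sqrtr_ge0.
rewrite !big_split/= !prodr_const card_ord -/Z.
rewrite le_eqVlt; apply/orP; left; apply/eqP.
have -> : \prod_(j < p) t j = W by [].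
by rewrite /Z exprMn; ring.
Qed.

End Pointwise.

(** Resolves the implicit estimate g <= O(L) + 2 P ln g, where L = [LM + LW] and [lg] stands for ln
    g: the linear bound on ln g with slope 1/(4P) costs only half of g, which moves to the left-hand
    side. *)
Lemma growth_arith (c K1 P LM LW lg g : R) :
  1 <= P -> ln c <= LM -> 0 <= LW -> 1 <= LM + LW ->
  lg <= g / (4 * P) + ln (4 * P) ->
  g <= 1 + (K1 + LM + (1 + 2 * P) * LW + 2 * P * lg) - ln c ->
  g <= 2 * (`|1 - ln c + K1 + 2 * P * ln (4 * P) - 2 * P * ln c| + 1 + 2 * P) *
       (LM + LW).
Proof.
move=> P1 cLM LW0 L1 hlg hg.
set A := 1 - ln c + K1 + 2 * P * ln (4 * P) - 2 * P * ln c.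
have hlg2 : 2 * P * lg <= g / 2 + 2 * P * ln (4 * P).
  have -> : g / 2 + 2 * P * ln (4 * P) = 2 * P * (g / (4 * P) + ln (4 * P)).
    by field; lra.
  by rewrite ler_wpM2l//; lra.
have h1 : g / 2 <= A + (1 + 2 * P) * (LM + LW).
  have h2 : 2 * P * ln c <= 2 * P * LM by rewrite ler_wpM2l//; lra.
  rewrite /A; nra.
have h3 : A <= `|A| * (LM + LW).
  apply: le_trans (ler_norm A) _; rewrite -[leLHS]mulr1 ler_wpM2l//.
nra.
Qed.

(** Taking logarithms in [mass_le_sgrowth] gives the hypothesis of [growth_arith], hence g <= A L;
    substituting this back eliminates g. The restriction d <= 1 keeps the exponent p (1 + 3d) / 2 of
    A below 2p, so C is uniform in d. *)
Lemma growth_estimate : exists2 C : R, 1 <= C & forall d r M,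
  0 < d -> d <= 1 -> open_corner rho r ->
  (forall j, ~ mean_set b n0 rho d j r) ->
  (forall j, ~ variance_set b rho d j r) ->
  (forall n, b n * rmonomial n r <= M) ->
  1 <= ln (M * logw r) ->
  mass b r <= C * M * (logw r `^ (1 + 2 * p%:R * d) *
     ln (M * logw r) `^ (p%:R / 2 * (1 + 3 * d))) /\
  (forall j, smean b j r <= C * (logw r * ln (M * logw r)) ^+ 2).
Proof.
pose c := low_term b n0 rho; have c0 : 0 < c by exact: low_term_gt0.
pose P : R := p%:R; have P1 : 1 <= P by rewrite ler1n.
pose C1 : R := 4 * Num.sqrt (2 * p%:R) + 1.
have C11 : 1 <= C1 by rewrite lerDr mulr_ge0// sqrtr_ge0.
pose K1 := ln (2 * C1 ^+ p).
pose A := 2 * (`|1 - ln c + K1 + 2 * P * ln (4 * P) - 2 * P * ln c| + 1 + 2 * P).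
have A1 : 1 <= A.
  have := normr_ge0 (1 - ln c + K1 + 2 * P * ln (4 * P) - 2 * P * ln c).
  by rewrite /A; lra.
have B1 : 1 <= 2 * C1 ^+ p * A ^+ (2 * p).
  by rewrite mulr_ege1 ?exprn_ege1// mulr_ege1 ?exprn_ege1// ler1n.
(* The first summand serves the mass, the second the means. *)
exists (2 * C1 ^+ p * A ^+ (2 * p) + A ^+ 2).
  by rewrite (le_trans B1)// lerDl sqr_ge0.
move=> d r M d0 d1 ro rmean rvar bM L1.
set W := logw r in L1 *; set L := ln (M * W) in L1 *.
have W1 : 1 <= W by exact: logw_ge1.
have W0 : 0 < W := lt_le_trans ltr01 W1.
have cM : c <= M.
  apply: le_trans (bM n0); rewrite /c /low_term ler_wpM2l//.
  by apply: rmonomial_ge => //; exact: open_corner_closed.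
have M0 : 0 < M := lt_le_trans c0 cM.
pose g := sgrowth b n0 rho r.
have g1 : 1 <= g by exact: sgrowth_ge1.
have g0 : 0 < g := lt_le_trans ltr01 g1.
have hG := mass_le_sgrowth d0 d1 ro rmean rvar bM.
rewrite -/C1 -/W -/g in hG.
have G0p : 0 < mass b r by apply: (lt_le_trans c0); exact: low_term_le_mass.
have Lsum : L = ln M + ln W by rewrite /L lnM// posrE.
have gL : g <= A * L.
  rewrite Lsum; apply: (@growth_arith c K1 P (ln M) (ln W) (ln g)) => //.
  - by rewrite ler_ln.
  - exact: ln_ge0.
  - by rewrite -Lsum.
  - have q0 : 0 < g / (4 * P) by rewrite divr_gt0// mulr_gt0// (lt_le_trans _ P1).
    have P40 : 0 < 4 * P by rewrite mulr_gt0// (lt_le_trans _ P1).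
    have -> : ln g = ln (g / (4 * P)) + ln (4 * P).
      by rewrite -lnM ?posrE// divfK// gt_eqF.
    by rewrite lerD2r ltW// ln_sublinear.
  - have eg : g = 1 + ln (mass b r) - ln c.
      by rewrite /g /sgrowth ln_div ?posrE// addrA.
    rewrite [leLHS]eg lerD2r lerD2l.
    apply: (@le_trans _ _ (ln (2 * C1 ^+ p * M * W *
       (g `^ ((1 + 3 * d) / 2) * W `^ (2 * d)) ^+ p))).
      rewrite ler_ln ?posrE//.
      by rewrite (lt_le_trans G0p).
    have C10 : 0 < C1 by exact: lt_le_trans C11.
    have C1p : 0 < C1 ^+ p by rewrite exprn_gt0// (lt_le_trans _ C11).
    have gw : 0 < g `^ ((1 + 3 * d) / 2) * W `^ (2 * d) by rewrite mulr_gt0// powR_gt0.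
    rewrite lnM ?posrE ?mulr_gt0 ?exprn_gt0//.
    rewrite lnM ?posrE ?mulr_gt0//.
    rewrite lnM ?posrE ?mulr_gt0// -/K1 lnXn//.
    rewrite lnM ?posrE ?powR_gt0// !ln_powR -[_ *+ p]mulr_natl -/P.
    have lg0 : 0 <= ln g by rewrite ln_ge0.
    have lW0 : 0 <= ln W by rewrite ln_ge0.
    have e1 : P * ((1 + 3 * d) / 2 * ln g) <= 2 * P * ln g.
      rewrite mulrA ler_wpM2r//; nra.
    have e2 : P * (2 * d * ln W) <= 2 * P * ln W.
      by rewrite mulrA ler_wpM2r//; nra.
    by rewrite mulrDr; lra.
have L0 : 0 < L := lt_le_trans ltr01 L1.
have A0 : 0 <= A := le_trans ler01 A1.
have AL0 : 0 <= A * L := mulr_ge0 A0 (ltW L0).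
split.
  apply: le_trans hG _.
  have -> : (g `^ ((1 + 3 * d) / 2) * W `^ (2 * d)) ^+ p =
      g `^ (P / 2 * (1 + 3 * d)) * W `^ (2 * P * d).
    rewrite exprMn -!powR_mulrn ?powR_ge0// -!powRrM -/P.
    by congr (_ `^ _ * _ `^ _); ring.
  have -> : W `^ (1 + 2 * P * d) = W * W `^ (2 * P * d).
    rewrite powRD; last by rewrite (gt_eqF W0) implybT.
    by rewrite powRr1// ltW.
  have e0 : 0 <= P / 2 * (1 + 3 * d) by nra.
  have hg : g `^ (P / 2 * (1 + 3 * d)) <= A ^+ (2 * p) * L `^ (P / 2 * (1 + 3 * d)).
    apply: (@le_trans _ _ ((A * L) `^ (P / 2 * (1 + 3 * d)))).
      by apply: ge0_ler_powR; rewrite ?nnegrE ?(ltW g0) ?AL0.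
    rewrite powRM ?(ltW L0)//.
    rewrite ler_wpM2r ?powR_ge0// -powR_mulrn//.
    rewrite ler_powR// natrM -/P; nra.
  have D0 : 0 <= 2 * C1 ^+ p * M * W.
    by rewrite !mulr_ge0 ?exprn_ge0 ?(ltW M0) ?(ltW W0)//; lra.
  apply: (@le_trans _ _ (2 * C1 ^+ p * M * W *
     ((A ^+ (2 * p) * L `^ (P / 2 * (1 + 3 * d))) * W `^ (2 * P * d)))).
    by rewrite ler_wpM2l// ler_wpM2r// powR_ge0.
  rewrite -/P; set X := L `^ _; set V := W `^ _.
  have -> : 2 * C1 ^+ p * M * W * (A ^+ (2 * p) * X * V) =
    (2 * C1 ^+ p * A ^+ (2 * p)) * (M * (W * V * X)) by ring.
  rewrite -[leRHS]mulrA ler_wpM2r ?lerDl ?sqr_ge0//.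
  by rewrite !mulr_ge0 ?powR_ge0// ltW.
move=> j; apply: le_trans (smean_le d1 ro rmean j) _.
rewrite -/W -/g; apply: (@le_trans _ _ (W ^+ 2 * (A * L) ^+ 2)).
  by rewrite ler_wpM2l ?sqr_ge0// lerXn2r ?nnegrE ?(ltW g0)// (le_trans (ltW g0)).
have -> : W ^+ 2 * (A * L) ^+ 2 = A ^+ 2 * (W * L) ^+ 2 by rewrite !exprMn; ring.
by rewrite ler_wpM2r ?sqr_ge0// lerDr (le_trans ler01).
Qed.

End Growth.
(** * Multiplicative systems *)

Section MultiplicativeSystem.
Context d {T : measurableType d} {R : realType}.
Variables (mu : {measure set T -> \bar R}) (D : set T).
Hypotheses (mD : measurable D) (muD : (mu D <= 1)%E).

(** From e^y <= 1/(1 - y) and (1 + y + 2 y^2)(1 - y) = 1 + y^2 (1 - 2y) >= 1. *)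
Lemma expR_le_quadratic (y : R) : y <= 1 / 2 -> expR y <= 1 + y + 2 * y ^+ 2.
Proof.
move=> y1; have h : 1 - y <= expR (- y) by exact: expR_ge1Dx.
have ey : 0 < expR y by exact: expR_gt0.
have : expR y * (1 - y) <= 1.
  by apply: le_trans (ler_wpM2l (ltW ey) h) _; rewrite expRN divff// gt_eqF.
move=> h2.
have h3 : 1 <= (1 + y + 2 * y ^+ 2) * (1 - y).
  have -> : (1 + y + 2 * y ^+ 2) * (1 - y) = 1 + y ^+ 2 * (1 - 2 * y) by ring.
  by rewrite lerDl mulr_ge0 ?sqr_ge0//; lra.
have y0 : 0 < 1 - y by lra.
by rewrite -(ler_pM2r y0); exact: le_trans h2 h3.
Qed.

Let fin : (mu D < +oo)%E. Proof. by rewrite (le_lt_trans muD)// ltry. Qed.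

Definition bounded_measurable (f : T -> R) : Prop :=
  measurable_fun D f /\ exists M, forall t, D t -> `|f t| <= M.

Lemma bounded_measurable_integrable f : bounded_measurable f ->
  mu.-integrable D (EFin \o f).
Proof.
move=> [mf [M hM]]; apply: measurable_bounded_integrable => //.
exists M; split; first exact: num_real.
by move=> x Mx t Dt; rewrite /= (le_trans (hM t Dt))// ltW.
Qed.

Lemma bounded_measurable_cst c : bounded_measurable (fun=> c).
Proof. by split => //; exists `|c|. Qed.

Lemma bounded_measurableD f g : bounded_measurable f -> bounded_measurable g ->
  bounded_measurable (fun t => f t + g t).
Proof.
move=> [mf [M hM]] [mg [M' hM']]; split; first exact: measurable_funD.
exists (M + M') => t Dt; apply: le_trans (ler_normD _ _) _.
by rewrite lerD ?hM ?hM'.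
Qed.

Lemma bounded_measurableM f g : bounded_measurable f -> bounded_measurable g ->
  bounded_measurable (fun t => f t * g t).
Proof.
move=> [mf [M hM]] [mg [M' hM']]; split; first exact: measurable_funM.
by exists (M * M') => t Dt; rewrite normrM ler_pM ?hM ?hM'.
Qed.

Lemma bounded_measurable_prod (I : Type) (s : seq I) (f : I -> T -> R) :
  (forall i, bounded_measurable (f i)) ->
  bounded_measurable (fun t => \prod_(i <- s) f i t).
Proof.
move=> bf; elim: s => [|x s IH].
  by under eq_fun do rewrite big_nil; exact: bounded_measurable_cst.
by under eq_fun do rewrite big_cons; exact: bounded_measurableM.
Qed.

Variables (I : choiceType) (X : I -> T -> R).
Hypothesis mX : forall i, measurable_fun D (X i).
Hypothesis X1 : forall i t, D t -> `|X i t| <= 1.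
Hypothesis X_MS : forall s : seq I, s != [::] -> uniq s ->
  (\int[mu]_(t in D) (\prod_(i <- s) X i t)%:E = 0)%E.

Let bX i : bounded_measurable (X i).
Proof. by split; [exact: mX|exists 1 => t; exact: X1]. Qed.

(** The product is expanded one factor at a time, and q collects the X_i picked so far; only the
    branch that never picks one has a nonzero integral. *)
Lemma Rintegral_prod_affine (al c : I -> R) (s q : seq I) : uniq (q ++ s) ->
  \int[mu]_(t in D) ((\prod_(i <- q) X i t) * \prod_(i <- s) (al i + c i * X i t)) =
  if q == [::] then (\prod_(i <- s) al i) * fine (mu D) else 0.
Proof.
have baff i : bounded_measurable (fun t => al i + c i * X i t).
  apply: bounded_measurableD; first exact: bounded_measurable_cst.
  by apply: bounded_measurableM => //; exact: bounded_measurable_cst.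
have bprod q' s' : bounded_measurable (fun t =>
    (\prod_(i <- q') X i t) * \prod_(i <- s') (al i + c i * X i t)).
  by apply: bounded_measurableM; exact: bounded_measurable_prod.
elim: s q => [|x s IH] q.
  rewrite cats0 => uq; under eq_Rintegral do rewrite big_nil mulr1.
  case: eqVneq => [->|q0].
    under eq_Rintegral do rewrite big_nil.
    by rewrite /Rintegral integral_cst// mul1e big_nil mul1r.
  by rewrite /Rintegral X_MS.
move=> uq.
have ux : uniq ((x :: q) ++ s).
  by rewrite -(perm_uniq (s1 := q ++ x :: s))// -cat1s perm_catCA.
have uq' : uniq (q ++ s) by move: ux => /= /andP[].
have -> : \int[mu]_(t in D) ((\prod_(i <- q) X i t) * \prod_(i <- x :: s) (al i + c i * X i t)) =
  \int[mu]_(t in D) (al x * ((\prod_(i <- q) X i t) * \prod_(i <- s) (al i + c i * X i t)) +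
    c x * ((\prod_(i <- x :: q) X i t) * \prod_(i <- s) (al i + c i * X i t))).
  by apply: eq_Rintegral => t _; rewrite !big_cons; ring.
have bi q' := bounded_measurable_integrable (bprod q' s).
rewrite RintegralD//; first last.
- apply: bounded_measurable_integrable; apply: bounded_measurableM => //.
  exact: bounded_measurable_cst.
- apply: bounded_measurable_integrable; apply: bounded_measurableM => //.
  exact: bounded_measurable_cst.
rewrite !RintegralZl// (IH q uq') (IH (x :: q) ux) mulr0 addr0.
by case: eqVneq => [_|]; rewrite ?mulr0// big_cons mulrA.
Qed.

(* Apply e^y <= 1 + y + 2 y^2 to y = c_i X_i: in the product of these bounds every
   mixed term integrates to zero. *)
Lemma integral_expR_MS_le (s : seq I) (c : I -> R) : uniq s ->
  \sum_(i <- s) c i ^+ 2 <= 1 / 4 ->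
  (\int[mu]_(t in D) (expR (\sum_(i <- s) c i * X i t))%:E <= (expR 1)%:E)%E.
Proof.
move=> us cs.
(* The constant 1/4 is what places each c_i X_i in the range of [expR_le_quadratic]. *)
have c12 i : i \in s -> `|c i| <= 1 / 2.
  move=> si; have h : c i ^+ 2 <= 1 / 4.
    apply: le_trans cs; rewrite (big_rem i)//= lerDl.
    by apply: sumr_ge0 => j _; exact: sqr_ge0.
  rewrite -(@ler_pXn2r _ 2)// ?nnegrE//.
  by rewrite real_normK ?num_real// (le_trans h)// expr2; lra.
pose F t := (\prod_(i <- [::]) X i t) * \prod_(i <- s) (1 + 2 * c i ^+ 2 + c i * X i t).
have bF : bounded_measurable F.
  apply: bounded_measurableM; apply: bounded_measurable_prod => // i.
  apply: bounded_measurableD; first exact: bounded_measurable_cst.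
  by apply: bounded_measurableM => //; exact: bounded_measurable_cst.
have eF t : D t -> expR (\sum_(i <- s) c i * X i t) <= F t.
  move=> Dt; rewrite /F big_nil mul1r expR_sum.
  rewrite big_seq [leRHS]big_seq; apply: ler_prod => i si.
  rewrite expR_ge0/=.
  have xi := X1 i Dt.
  have yi : `|c i * X i t| <= 1 / 2.
    by rewrite normrM -[leRHS]mulr1 ler_pM// c12.
  apply: le_trans (expR_le_quadratic (le_trans (ler_norm _) yi)) _.
  have : X i t ^+ 2 <= 1.
    by rewrite -real_normK ?num_real// exprn_ile1.
  move=> x2; have : c i ^+ 2 * X i t ^+ 2 <= c i ^+ 2 by rewrite ler_piMr// sqr_ge0.
  rewrite exprMn; lra.
apply: (@le_trans _ _ (\int[mu]_(t in D) (F t)%:E)%E).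
  apply: ge0_le_integral => //.
  - apply/measurable_EFinP; apply: measurableT_comp; first exact: measurable_expR.
    by apply: measurable_sum => i; apply: measurable_funM.
  - by apply/measurable_EFinP; case: bF.
have fi := bounded_measurable_integrable bF.
rewrite -[leLHS]fineK; last exact: integrable_fin_num.
rewrite lee_fin -/(Rintegral mu D F) Rintegral_prod_affine//=.
have mD1 : fine (mu D) <= 1.
  by rewrite -lee_fin fineK// ge0_fin_numE.
have p0 : 0 <= \prod_(i <- s) (1 + 2 * c i ^+ 2).
  by apply: prodr_ge0 => i _; rewrite addr_ge0// mulr_ge0// sqr_ge0.
apply: (@le_trans _ _ (\prod_(i <- s) (1 + 2 * c i ^+ 2))).
  by rewrite ler_piMr.
apply: (@le_trans _ _ (expR (\sum_(i <- s) 2 * c i ^+ 2))).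
  rewrite expR_sum; apply: ler_prod => i _.
  by rewrite expR_ge1Dx andbT addr_ge0// mulr_ge0// sqr_ge0.
by rewrite ler_expR -mulr_sumr; lra.
Qed.

(** Plays the part of Borel-Cantelli: the sum of all phi_N is integrable, hence almost everywhere
    finite, and bounds each term. The weights 1/((N+1)(N+2)) telescope to 1 - 1/(K+1). *)
Lemma ae_bounded_of_summable (C : R) (phi : nat -> T -> R) :
  (forall N, measurable_fun D (phi N)) -> (forall N t, D t -> 0 <= phi N t) ->
  (forall N, (\int[mu]_(t in D) (phi N t)%:E <= (C / (N.+1 * N.+2)%:R)%:E)%E) ->
  {ae mu, forall t, D t -> exists B, forall N, phi N t <= B}.
Proof.
move=> mphi phi0 hphi.
pose S t := (\sum_(N <oo) (phi N t)%:E)%E.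
have mS : measurable_fun D S.
  by apply: ge0_emeasurable_sum => [N t Dt _|N _]; [rewrite lee_fin phi0|exact/measurable_EFinP].
have S0 t : D t -> (0 <= S t)%E.
  by move=> Dt; apply: nneseries_ge0 => N _ _; rewrite lee_fin phi0.
have iS : mu.-integrable D S.
  apply/integrableP; split => //.
  under eq_integral => t tD do rewrite (gee0_abs (S0 _ (set_mem tD))).
  rewrite integral_nneseries//; last by move=> N; apply/measurable_EFinP.
  apply: (@le_lt_trans _ _ (`|C|)%:E); last exact: ltry.
  apply: lime_le.
    apply: is_cvg_nneseries => N _ _.
    by apply: integral_ge0 => t Dt; rewrite lee_fin phi0.
  near=> K.
  apply: (@le_trans _ _ (\sum_(0 <= N < K) (`|C| / (N.+1 * N.+2)%:R)%:E)%E).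
    apply: lee_sum => N _; apply: le_trans (hphi N) _.
    by rewrite lee_fin ler_wpM2r// ler_norm.
  rewrite sumEFin lee_fin.
  suff -> : \sum_(0 <= N < K) `|C| / (N.+1 * N.+2)%:R = `|C| * (1 - K.+1%:R^-1).
    by rewrite ler_piMr// lerBlDr lerDl invr_ge0.
  elim: {+}K => [|k IH]; first by rewrite big_geq// invr1 subrr mulr0.
  rewrite big_nat_recr//= IH natrM -(natr1 k.+1).
  by field; rewrite !nat1r natr1 !pnatr_eq0.
have := integrable_ae mD iS.
apply: filterS => t ht Dt.
exists (fine (S t)) => N; rewrite -lee_fin fineK; last exact: ht.
have h := @nneseries_lim_ge R (fun N => (phi N t)%:E) xpredT 0 N.+1.
apply: le_trans (h _); last by move=> n _ _; rewrite lee_fin phi0.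
rewrite big_nat_recr//= leeDr//.
by apply: sume_ge0 => n _; rewrite lee_fin phi0.
Unshelve. all: by end_near. Qed.

(** The average over w of the exponentials, divided by (N+1)(N+2), has summable integrals. Once it
    is bounded by B, each single exponential is at most B times the normalizing factor, as all are
    nonnegative; take logarithms. *)
Lemma ae_MS_family_bound (s : nat -> seq I) (Gam : nat -> finType)
    (c : forall N, Gam N -> I -> R) :
  (forall N, uniq (s N)) ->
  (forall N w, \sum_(i <- s N) c N w i ^+ 2 <= 1 / 4) ->
  {ae mu, forall t, D t -> exists2 B, 1 <= B & forall N (w : Gam N),
     \sum_(i <- s N) c N w i * X i t <= ln (B * (N.+1 * N.+2 * #|Gam N|)%:R)}.
Proof.
move=> us hc.
pose E N w t := expR (\sum_(i <- s N) c N w i * X i t).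
pose phi N t := (N.+1 * N.+2 * #|Gam N|)%:R^-1 * \sum_(w : Gam N) E N w t.
have mE N w : measurable_fun D (E N w).
  apply: measurableT_comp; first exact: measurable_expR.
  by apply: measurable_sum => i; apply: measurable_funM.
have E0 N w t : 0 <= E N w t by exact: expR_ge0.
have mphi N : measurable_fun D (phi N).
  by apply: measurable_funM => //; exact: measurable_sum.
have phi0 N t : D t -> 0 <= phi N t.
  by move=> _; rewrite mulr_ge0 ?invr_ge0 ?sumr_ge0.
have hphi N : (\int[mu]_(t in D) (phi N t)%:E <= (expR 1 / (N.+1 * N.+2)%:R)%:E)%E.
  rewrite /phi.
  under eq_integral => t _ do rewrite EFinM.
  rewrite ge0_integralZl//; last 2 first.
  - by apply/measurable_EFinP; exact: measurable_sum.
  - by move=> t _; rewrite lee_fin sumr_ge0.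
  under eq_integral => t _ do rewrite -sumEFin.
  rewrite ge0_integral_sum//; last 2 first.
  - by move=> w; apply/measurable_EFinP; exact: mE.
  - by move=> w t _; rewrite lee_fin E0.
  apply: (@le_trans _ _ ((N.+1 * N.+2 * #|Gam N|)%:R^-1%:E * (\sum_(w : Gam N) (expR 1)%:E))%E).
    apply: lee_wpmul2l; first by rewrite lee_fin invr_ge0.
    by apply: lee_sum => w _; exact: integral_expR_MS_le.
  rewrite sumEFin -EFinM lee_fin sumr_const -[expR 1 *+ _]mulr_natr.
  (* For an empty index set the inverse is 0 by convention and the bound is trivial. *)
  have [->|G0] := eqVneq #|Gam N| 0%N.
    by rewrite !mulr0 divr_ge0 ?expR_ge0.
  have g0 : (#|Gam N|%:R : R) != 0 by rewrite pnatr_eq0.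
  by rewrite natrM invfM mulrACA mulVf// mulr1 mulrC.
have := ae_bounded_of_summable mphi phi0 hphi.
apply: filterS => t ht Dt; have [B hB] := ht Dt.
exists (Num.max B 1); first by rewrite le_max lexx orbT.
move=> N w; set B' := Num.max B 1.
have Gpos : (0 < #|Gam N|)%N by apply/card_gt0P; exists w.
have Apos : 0 < (N.+1 * N.+2 * #|Gam N|)%:R :> R by rewrite ltr0n !muln_gt0.
have B'0 : 0 < B' by rewrite lt_max ltr01 orbT.
rewrite -ler_expR lnK ?posrE ?mulr_gt0//.
have := hB N; rewrite /phi mulrC ler_pdivrMr// => h2.
apply: (@le_trans _ _ (B * (N.+1 * N.+2 * #|Gam N|)%:R)); last first.
  by rewrite ler_wpM2r ?(ltW Apos)// le_max lexx.
apply: le_trans h2; rewrite (bigD1 w)//= lerDl.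
by apply: sumr_ge0.
Qed.

End MultiplicativeSystem.
(** * Discretization of the polydisc *)

Section ComplexEstimates.
Context {R : realType}.
Implicit Types (x y z : R[i]).
Local Notation Re := complex.Re.
Local Notation Im := complex.Im.

Lemma normc_ge0 z : 0 <= normc z.
Proof. by case: z => a b; exact: sqrtr_ge0. Qed.

Lemma normcD_le x y : normc (x + y) <= normc x + normc y.
Proof. by rewrite -lecR rmorphD/=; exact: (@ler_normD _ R[i] x y). Qed.

Lemma normcM_eq x y : normc (x * y) = normc x * normc y.
Proof. exact: ComplexField.Normc.normcM. Qed.

Lemma normc_prodE (I : Type) (s : seq I) (f : I -> R[i]) :
  normc (\prod_(i <- s) f i) = \prod_(i <- s) normc (f i).
Proof. by apply: (big_morph _ normcM_eq); exact: ComplexField.Normc.normc1. Qed.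

Lemma normcX z k : normc (z ^+ k) = normc z ^+ k.
Proof.
elim: k => [|k IH]; first by rewrite !expr0; exact: ComplexField.Normc.normc1.
by rewrite !exprS normcM_eq IH.
Qed.

Lemma normc_sum_le (I : Type) (s : seq I) (Q : pred I) (f : I -> R[i]) :
  normc (\sum_(i <- s | Q i) f i) <= \sum_(i <- s | Q i) normc (f i).
Proof.
elim: s => [|i s IH]; first by rewrite !big_nil; rewrite (ComplexField.Normc.normc0 R).
by rewrite !big_cons; case: ifP => // _; rewrite (le_trans (normcD_le _ _))// lerD2l.
Qed.

Lemma normc_le_ReIm z : normc z <= `|Re z| + `|Im z|.
Proof.
case: z => a b /=; rewrite -[leRHS]ger0_norm ?addr_ge0// -sqrtr_sqr ler_wsqrtr//.
rewrite sqrrD !real_normK ?num_real// addrAC lerDl.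
by rewrite mulrn_wge0// mulr_ge0.
Qed.

Lemma Re_le_normc z : `|Re z| <= normc z.
Proof.
case: z => a b /=; rewrite -sqrtr_sqr ler_wsqrtr// lerDl; exact: sqr_ge0.
Qed.

Lemma Im_le_normc z : `|Im z| <= normc z.
Proof.
case: z => a b /=; rewrite -sqrtr_sqr ler_wsqrtr// lerDr; exact: sqr_ge0.
Qed.

Lemma normc_le_coord x y : `|Re x| <= `|Re y| -> `|Im x| <= `|Im y| ->
  normc x <= normc y.
Proof.
case: x y => a b [a' b'] /= h1 h2; apply: ler_wsqrtr.
by apply: lerD; rewrite -[leLHS]real_normK ?num_real// -[leRHS]real_normK ?num_real//
  lerXn2r ?nnegrE.
Qed.

Lemma ReD x y : Re (x + y) = Re x + Re y.
Proof. by case: x y => a b [a' b']. Qed.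

Lemma ImD x y : Im (x + y) = Im x + Im y.
Proof. by case: x y => a b [a' b']. Qed.

Lemma Re_sum (I : Type) (s : seq I) (f : I -> R[i]) :
  Re (\sum_(i <- s) f i) = \sum_(i <- s) Re (f i).
Proof. exact: (big_morph _ ReD). Qed.

Lemma Im_sum (I : Type) (s : seq I) (f : I -> R[i]) :
  Im (\sum_(i <- s) f i) = \sum_(i <- s) Im (f i).
Proof. exact: (big_morph _ ImD). Qed.

(** The real and imaginary parts of Z are multiplicative systems separately, not jointly, hence four
    real sums, each linear in just one of them. *)
Lemma normc_sumM_le (I : Type) (s : seq I) (u Z : I -> R[i]) (E : R) :
  `|\sum_(i <- s) Re (u i) * Re (Z i)| <= E ->
  `|\sum_(i <- s) Im (u i) * Re (Z i)| <= E ->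
  `|\sum_(i <- s) Re (u i) * Im (Z i)| <= E ->
  `|\sum_(i <- s) Im (u i) * Im (Z i)| <= E ->
  normc (\sum_(i <- s) u i * Z i) <= 4 * E.
Proof.
move=> h1 h2 h3 h4; apply: le_trans (normc_le_ReIm _) _.
have -> : Re (\sum_(i <- s) u i * Z i) =
  \sum_(i <- s) Re (u i) * Re (Z i) - \sum_(i <- s) Im (u i) * Im (Z i).
  by rewrite Re_sum -sumrB; apply: eq_bigr => i _; case: (u i) (Z i) => a b [a' b'].
have -> : Im (\sum_(i <- s) u i * Z i) =
  \sum_(i <- s) Re (u i) * Im (Z i) + \sum_(i <- s) Im (u i) * Re (Z i).
  by rewrite Im_sum -big_split/=; apply: eq_bigr => i _; case: (u i) (Z i) => a b [a' b'].
have e1 := ler_normB (\sum_(i <- s) Re (u i) * Re (Z i)) (\sum_(i <- s) Im (u i) * Im (Z i)).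
have e2 := ler_normD (\sum_(i <- s) Re (u i) * Im (Z i)) (\sum_(i <- s) Im (u i) * Re (Z i)).
lra.
Qed.

(** Errors are measured relative to the radii: they then add up along a product and leave the factor
    r^n intact, so the discretization error can be compared with G(r). *)
Lemma normc_prodB_le (I : Type) (s : seq I) (x y : I -> R[i]) (r e : I -> R) :
  (forall i, normc (x i) <= r i) -> (forall i, normc (y i) <= r i) ->
  (forall i, 0 <= e i) ->
  (forall i, normc (x i - y i) <= r i * e i) ->
  normc (\prod_(i <- s) x i - \prod_(i <- s) y i) <=
  (\prod_(i <- s) r i) * \sum_(i <- s) e i.
Proof.
move=> xr yr e0 xye; elim: s => [|i s IH].
  by rewrite !big_nil subrr mulr0 (ComplexField.Normc.normc0 R).
rewrite !big_cons.
have -> : x i * (\prod_(j <- s) x j) - y i * (\prod_(j <- s) y j) =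
    (x i - y i) * (\prod_(j <- s) x j) +
    y i * (\prod_(j <- s) x j - \prod_(j <- s) y j) by ring.
apply: le_trans (normcD_le _ _) _; rewrite !normcM_eq.
have r0 j : 0 <= r j by apply: le_trans (xr j); exact: normc_ge0.
have h1 : normc (x i - y i) * normc (\prod_(j <- s) x j) <=
    (r i * e i) * \prod_(j <- s) r j.
  apply: ler_pM; rewrite ?normc_ge0//.
  by rewrite normc_prodE; apply: ler_prod => j _; rewrite normc_ge0/=.
have h2 : normc (y i) * normc (\prod_(j <- s) x j - \prod_(j <- s) y j) <=
    r i * ((\prod_(j <- s) r j) * \sum_(j <- s) e j).
  by apply: ler_pM; rewrite ?normc_ge0.
apply: le_trans (lerD h1 h2) _.
by rewrite le_eqVlt; apply/orP; left; apply/eqP; ring.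
Qed.

Lemma normcXB_le x y (r e : R) k : normc x <= r -> normc y <= r -> 0 <= e ->
  normc (x - y) <= r * e -> normc (x ^+ k - y ^+ k) <= r ^+ k * (k%:R * e).
Proof.
move=> xr yr e0 h.
have := @normc_prodB_le 'I_k (index_enum 'I_k) (fun=> x) (fun=> y) (fun=> r) (fun=> e)
  (fun=> xr) (fun=> yr) (fun=> e0) (fun=> h).
by rewrite !prodr_const sumr_const card_ord mulr_natl.
Qed.

Lemma monomialB_le (p : nat) (n : multi_index p) (z w : 'rV[R[i]^o]_p)
    (r : Rtuple R p) (e : R) :
  (forall j, normc (z 0 j) <= (tnth r j : R)) ->
  (forall j, normc (w 0 j) <= (tnth r j : R)) -> 0 <= e ->
  (forall j, normc (z 0 j - w 0 j) <= (tnth r j : R) * e) ->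
  normc (monomial z n - monomial w n) <= rmonomial n r * ((degree n)%:R * e).
Proof.
move=> zr wr e0 zwe; rewrite /monomial /rmonomial /degree natr_sum mulr_suml.
apply: normc_prodB_le => j.
- rewrite normcX lerXn2r ?nnegrE ?normc_ge0//.
  by apply: le_trans (zr j); exact: normc_ge0.
- rewrite normcX lerXn2r ?nnegrE ?normc_ge0//.
  by apply: le_trans (wr j); exact: normc_ge0.
- by rewrite mulr_ge0.
- by rewrite normcXB_le.
Qed.

Lemma normc_monomial_le (p : nat) (n : multi_index p) (z : 'rV[R[i]^o]_p)
    (r : Rtuple R p) : (forall j, normc (z 0 j) <= (tnth r j : R)) ->
  normc (monomial z n) <= rmonomial n r.
Proof.
move=> zr; rewrite /monomial normc_prodE; apply: ler_prod => j _.
rewrite normc_ge0/= normcX lerXn2r ?nnegrE ?normc_ge0//.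
by apply: le_trans (zr j); exact: normc_ge0.
Qed.

Definition grid_coord (m : nat) (k : 'I_(m.*2.+1)) : R := (k%:R - m%:R) / m%:R.

Lemma grid_coordP (m : nat) (x : R) : (0 < m)%N -> `|x| <= 1 ->
  exists k : 'I_(m.*2.+1),
    `|grid_coord k| <= `|x| /\ `|x - grid_coord k| <= m%:R^-1.
Proof.
move=> m0 x1; have mR : 0 < m%:R :> R by rewrite ltr0n.
pose q := Num.truncn (`|x| * m%:R).
have y0 : 0 <= `|x| * m%:R by rewrite mulr_ge0.
have /andP[q1 q2] := truncn_itv y0; rewrite -/q in q1 q2.
have qm : (q <= m)%N.
  rewrite -(ler_nat R) (le_trans q1)// -[leRHS]mul1r ler_wpM2r//.
have q1' : q%:R / m%:R <= `|x| by rewrite ler_pdivrMr.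
have q2' : `|x| - q%:R / m%:R <= m%:R^-1.
  rewrite lerBlDr (_ : _ + _ = (q%:R + 1) / m%:R); last by rewrite mulrDl mul1r addrC.
  by rewrite ler_pdivlMr// ltW// natr1.
have [x0|x0] := leP 0 x.
  have lt1 : (m + q < m.*2.+1)%N by rewrite ltnS -addnn leq_add2l.
  exists (Ordinal lt1).
  have -> : grid_coord (Ordinal lt1) = q%:R / m%:R.
    by rewrite /grid_coord /= natrD; congr (_ / _); ring.
  rewrite (ger0_norm x0) in q1' q2' *.
  by rewrite !ger0_norm// ?subr_ge0.
have lt1 : (m - q < m.*2.+1)%N.
  by rewrite ltnS (leq_trans (leq_subr _ _))// -addnn leq_addr.
exists (Ordinal lt1).
have -> : grid_coord (Ordinal lt1) = - (q%:R / m%:R).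
  by rewrite /grid_coord /= natrB// -mulNr; congr (_ / _); ring.
rewrite (ltr0_norm x0) in q1' q2' *.
split; first by rewrite normrN ger0_norm.
by rewrite opprK -normrN opprD ger0_norm// subr_ge0.
Qed.

Definition grid_point (p m : nat) (w : {ffun 'I_p -> 'I_(m.*2.+1) * 'I_(m.*2.+1)}) :
    'rV[R[i]^o]_p :=
  \row_j (grid_coord (w j).1 +i* grid_coord (w j).2)%C.

(* Rounding towards zero keeps the grid point in every polydisc containing z, so
   that its coefficients are bounded by those at the radii of z. *)
Lemma grid_pointP (p m : nat) (z : 'rV[R[i]^o]_p) : (0 < m)%N ->
  (forall j, normc (z 0 j) <= 1) ->
  exists w : {ffun 'I_p -> 'I_(m.*2.+1) * 'I_(m.*2.+1)},
    forall j, normc (grid_point w 0 j) <= normc (z 0 j) /\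
              normc (z 0 j - grid_point w 0 j) <= 2 / m%:R.
Proof.
move=> m0 z1.
have ex j : exists k : 'I_(m.*2.+1) * 'I_(m.*2.+1),
   [/\ `|grid_coord k.1| <= `|Re (z 0 j)|, `|Re (z 0 j) - grid_coord k.1| <= m%:R^-1,
     `|grid_coord k.2| <= `|Im (z 0 j)| & `|Im (z 0 j) - grid_coord k.2| <= m%:R^-1].
  have [k [h1 h2]] := @grid_coordP m (Re (z 0 j)) m0 (le_trans (Re_le_normc _) (z1 j)).
  have [l [h3 h4]] := @grid_coordP m (Im (z 0 j)) m0 (le_trans (Im_le_normc _) (z1 j)).
  by exists (k, l).
have [f hf] := choice ex.
exists [ffun j => f j] => j; have [h1 h2 h3 h4] := hf j.
rewrite /grid_point mxE ffunE; split; first exact: normc_le_coord.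
apply: le_trans (normc_le_ReIm _) _.
move: h2 h4; case: (z 0 j) => a b /= h2 h4.
by apply: le_trans (lerD h2 h4) _; rewrite mulrDl mul1r.
Qed.

End ComplexEstimates.

(** * Random polynomials at the grid points *)

Section RandomPolynomial.
Context {R : realType}.
Local Notation P := (@completed_lebesgue_measure R).
Local Notation Re := complex.Re.
Local Notation Im := complex.Im.

Lemma borel_lebesgue_line (A : set (measurableTypeR R)) : measurable A ->
  measurable (A : set (@lebesgue_line R)).
Proof. by move=> mA; apply: sub_caratheodory. Qed.

Lemma measurable_unit_interval : measurable (@unit_interval R).
Proof. by apply: borel_lebesgue_line; exact: measurable_itv. Qed.

Lemma completed_measure_unit_interval : (P (@unit_interval R) = 1)%E.
Proof.
transitivity (@lebesgue_measure R `[0%R, 1%R]) => //.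
by rewrite lebesgue_measure_itv/= lte_fin ltr01 oppr0 adde0.
Qed.

(** Removing a null set makes the almost sure bound on the system hold everywhere, as the
    exponential estimate requires, and does not affect the vanishing integrals. *)
Lemma real_MS_restrict (I : choiceType) (X : I -> @lebesgue_line R -> R)
    (A : set (@lebesgue_line R)) :
  real_MS X -> measurable A -> P A = 0%E ->
  forall s : seq I, s != [::] -> uniq s ->
  (\int[P]_(t in @unit_interval R `\` A) (\prod_(i <- s) X i t)%:E = 0)%E.
Proof.
move=> [mX hX] mA A0 s s0 us; rewrite -[RHS](hX s s0 us) /expectation01.
have mf : measurable_fun (@unit_interval R) (fun t => (\prod_(i <- s) X i t)%:E).
  by apply/measurable_EFinP; apply: measurable_prod => i _; exact: mX.
rewrite setDE integral_mkcondr; apply: ae_eq_integral => //.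
- exact: measurable_unit_interval.
- apply/(measurable_restrict _ _ _).
    exact: measurableC.
    exact: measurable_unit_interval.
  apply: measurable_funS mf; first exact: measurable_unit_interval.
  exact: subIsetl.
- exists A; split => // t /=.
  move=> /not_implyP[Dt h]; apply: contrapT => nA; apply: h.
  by rewrite patchE mem_set.
Qed.

Lemma real_MS_ae_family_bound (I : choiceType) (X : I -> @lebesgue_line R -> R)
    (s : nat -> seq I) (Gam : nat -> finType) (c : forall N, Gam N -> I -> R) :
  real_MS X ->
  {ae P, forall t, @unit_interval R t -> forall i, `|X i t| <= 1} ->
  (forall N, uniq (s N)) ->
  (forall N w, \sum_(i <- s N) c N w i ^+ 2 <= 1 / 4) ->
  {ae P, forall t, @unit_interval R t -> exists2 B, 1 <= B & forall N (w : Gam N),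
     \sum_(i <- s N) c N w i * X i t <= ln (B * (N.+1 * N.+2 * #|Gam N|)%:R)}.
Proof.
move=> hX [A [mA A0 hA]] us hc.
pose D := @unit_interval R `\` A.
have mD : measurable D by apply: measurableD => //; exact: measurable_unit_interval.
have muD : (P D <= 1)%E.
  rewrite -completed_measure_unit_interval; apply: le_measure.
  - exact/mem_set.
  - exact/mem_set/measurable_unit_interval.
  - exact: subDsetl.
have mX i : measurable_fun D (X i).
  apply: measurable_funS (hX.1 i); first exact: measurable_unit_interval.
  exact: subDsetl.
have X1 i t : D t -> `|X i t| <= 1.
  move=> [Dt nA]; apply: contrapT => h; apply: nA; apply: hA => /= h'.
  by apply: h; exact: h'.
have h := ae_MS_family_bound mD muD mX X1 (real_MS_restrict hX mA A0) us hc.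
have hA' : {ae P, forall t, ~ A t}.
  by exists A; split => // t /= /contrapT.
by apply: filterS2 h hA' => t h nA Dt; apply: h; split.
Qed.

(** The mesh is (N+1)^(-2): moving the argument of a polynomial of degree N costs a factor N, and an
    error of order 1/N must remain. *)
Definition grid_index (p N : nat) : finType :=
  {ffun 'I_p -> 'I_(((N.+1 ^ 2).*2).+1) * 'I_(((N.+1 ^ 2).*2).+1)}.

Section Polynomial.
Variables (p : nat) (a : multi_index p -> R[i]^o).

Definition grid_term N (w : grid_index p N) (n : multi_index p) : R[i] :=
  a n * monomial (grid_point (R := R) w) n.

Definition grid_norm N (w : grid_index p N) : R :=
  Num.sqrt (\sum_(n <- degree_seq p N) normc (grid_term w n) ^+ 2).

Definition grid_size (N : nat) : R :=
  (N.+1 * N.+2 * #|{: grid_index p N * (bool * bool)}|)%:R.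

(** The first boolean is a sign, so that one-sided bounds yield absolute values; the second selects
    the real or the imaginary part. *)
Let signed_part (e : bool * bool) (z : R[i]) : R :=
  (-1) ^+ e.1 * (if e.2 then Re z else Im z).

(** Dividing by twice the L^2 norm makes the sum of squares at most 1/4; if the norm is 0, the
    coefficients are 0 by convention. *)
Let coef N (w : grid_index p N * (bool * bool)) (n : multi_index p) : R :=
  signed_part w.2 (grid_term w.1 n) / (2 * grid_norm w.1).

Let sum_coef_sq N (w : grid_index p N * (bool * bool)) :
  \sum_(n <- degree_seq p N) coef w n ^+ 2 <= 1 / 4.
Proof.
have s0 : 0 <= \sum_(n <- degree_seq p N) normc (grid_term w.1 n) ^+ 2.
  by apply: sumr_ge0 => n _; exact: sqr_ge0.
have h n : coef w n ^+ 2 <= normc (grid_term w.1 n) ^+ 2 / (4 * grid_norm w.1 ^+ 2).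
  have -> : 4 * grid_norm w.1 ^+ 2 = (2 * grid_norm w.1) ^+ 2 by ring.
  rewrite /coef exprMn exprVn.
  apply: ler_wpM2r; first by rewrite invr_ge0 sqr_ge0.
  rewrite /signed_part exprMn sqrr_sign mul1r -[leLHS]real_normK ?num_real//.
  rewrite lerXn2r ?nnegrE ?normc_ge0//.
  by case: ifP => _; [exact: Re_le_normc|exact: Im_le_normc].
apply: le_trans (ler_sum _ (fun n _ => h n)) _.
rewrite -mulr_suml /grid_norm sqr_sqrtr//.
set S := \sum_(n <- _) _ in s0 *.
have [->|S0] := eqVneq S 0; first by rewrite mul0r divr_ge0.
rewrite le_eqVlt; apply/orP; left; apply/eqP; field.
exact: S0.
Qed.

Let signed_bound N (w : grid_index p N) (b : bool) (Y : multi_index p -> R) (L : R) :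
  (forall e : bool, \sum_(n <- degree_seq p N) coef (w, (e, b)) n * Y n <= L) ->
  `|\sum_(n <- degree_seq p N) (if b then Re (grid_term w n) else Im (grid_term w n)) * Y n|
    <= 2 * grid_norm w * L.
Proof.
(* If the norm vanishes, the hypothesis carries no information, but then every grid term is zero. *)
move=> h; have [S0|Sn0] := eqVneq (grid_norm w) 0.
  rewrite S0 mulr0 mul0r big1_seq ?normr0// => n /andP[_ nN].
  have z0 : grid_term w n = 0.
    have /eqP : \sum_(n <- degree_seq p N) normc (grid_term w n) ^+ 2 = 0.
      apply/eqP; rewrite eq_le sumr_ge0 ?andbT => [|k _]; last exact: sqr_ge0.
      by move/eqP: S0; rewrite sqrtr_eq0.
    rewrite psumr_eq0; last by move=> k _; exact: sqr_ge0.
    move=> /allP/(_ n nN)/=; rewrite expf_eq0/= => /eqP.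
    exact: ComplexField.Normc.eq0_normc.
  by rewrite z0; case: b {h}; rewrite mul0r.
have S0 : 0 < grid_norm w by rewrite lt0r Sn0 sqrtr_ge0.
set T := \sum_(n <- _) _.
have he e : (-1) ^+ (e : bool) * T <= 2 * grid_norm w * L.
  rewrite -ler_pdivrMl ?mulr_gt0//; apply: le_trans (h e).
  rewrite le_eqVlt; apply/orP; left; apply/eqP; rewrite /T !mulr_sumr.
  by apply: eq_bigr => n _; rewrite /coef /signed_part/=; ring.
rewrite ler_norml; have := he true; have := he false.
by rewrite expr0 expr1 mul1r mulN1r lerNl => -> ->.
Qed.

Lemma random_polynomial_bound (Z : multi_index p -> @lebesgue_line R -> R[i]) :
  complex_MS Z -> bounded_by_one Z ->
  {ae P, forall t, @unit_interval R t -> exists2 B, 1 <= B & forall N (w : grid_index p N),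
     normc (\sum_(n <- degree_seq p N) grid_term w n * Z n t) <=
     8 * grid_norm w * ln (B * grid_size N)}.
Proof.
move=> [hX hY] hZ.
pose Gam N : finType := (grid_index p N * (bool * bool))%type.
have X1 : {ae P, forall t, @unit_interval R t -> forall n, `|Re (Z n t)| <= 1}.
  by apply: filterS hZ => t h Dt n; exact: le_trans (Re_le_normc _) (h Dt n).
have Y1 : {ae P, forall t, @unit_interval R t -> forall n, `|Im (Z n t)| <= 1}.
  by apply: filterS hZ => t h Dt n; exact: le_trans (Im_le_normc _) (h Dt n).
have aX := real_MS_ae_family_bound (Gam := Gam) hX X1 (uniq_degree_seq p) sum_coef_sq.
have aY := real_MS_ae_family_bound (Gam := Gam) hY Y1 (uniq_degree_seq p) sum_coef_sq.
apply: filterS2 aX aY => t hx hy Dt.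
have [B B1 hB] := hx Dt; have [B' B'1 hB'] := hy Dt.
exists (Num.max B B'); first by rewrite le_max B1.
move=> N w; set L := ln _.
have c0 : 0 < grid_size N.
  rewrite /grid_size ltr0n !muln_gt0/=; apply/card_gt0P.
  by exists (w, (true, true)).
have LB C : 1 <= C -> C <= Num.max B B' -> ln (C * grid_size N) <= L.
  move=> C1 CB; have C0 : 0 < C := lt_le_trans ltr01 C1.
  rewrite ler_ln ?posrE ?mulr_gt0// ?ler_wpM2r ?(ltW c0)//.
  exact: lt_le_trans CB.
have hL (e b : bool) : \sum_(n <- degree_seq p N) coef (w, (e, b)) n * Re (Z n t) <= L.
  by apply: le_trans (hB N (w, (e, b))) _; apply: LB => //; rewrite le_max lexx.
have hL' (e b : bool) : \sum_(n <- degree_seq p N) coef (w, (e, b)) n * Im (Z n t) <= L.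
  by apply: le_trans (hB' N (w, (e, b))) _; apply: LB => //; rewrite le_max lexx orbT.
have -> : 8 * grid_norm w * L = 4 * (2 * grid_norm w * L) by ring.
apply: normc_sumM_le.
- exact: (@signed_bound N w true (fun n => Re (Z n t)) L (fun e => hL e true)).
- exact: (@signed_bound N w false (fun n => Re (Z n t)) L (fun e => hL e false)).
- exact: (@signed_bound N w true (fun n => Im (Z n t)) L (fun e => hL' e true)).
- exact: (@signed_bound N w false (fun n => Im (Z n t)) L (fun e => hL' e false)).
Qed.

End Polynomial.

End RandomPolynomial.
(** * The theorem *)

Section Assembly.
Context {R : realType} (p : nat).
Implicit Types (r u : Rtuple R p) (n : multi_index p).

(* Holds without convergence: the limit of a divergent sequence is 0. *)
Lemma normc_lim_le (u : nat -> R[i]^o) (X : R) (N : nat) :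
  0 <= X -> (forall k, (N <= k)%N -> normc (u k) <= X) -> normc (lim (u @ \oo)) <= X.
Proof.
move=> X0 uX; have [cu|ncu] := pselect (cvg (u @ \oo)); last first.
  by rewrite (dvgP ncu) (_ : point = 0)// (ComplexField.Normc.normc0 R).
rewrite leNgt; apply/negP => lX; set l := lim _ in lX cu.
have e0 : 0 < (normc l - X)%:C :> R[i] by rewrite ltcR subr_gt0.
have /cvgrPdist_lt/(_ _ e0)[K _ hK] := cu.
have := hK (maxn N K) (leq_maxr _ _).
rewrite -/l => h; have : normc (l - u (maxn N K)) < normc l - X by rewrite -ltcR.
have h1 := uX (maxn N K) (leq_maxl _ _).
have := normcD_le (l - u (maxn N K)) (u (maxn N K)); rewrite subrK.
lra.
Qed.

Section FiniteLogMeasure.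
Variable rho : R.

Definition finite_log_measure (A : set (Rtuple R p)) : Prop :=
  [/\ measurable A, A `<=` open_corner rho &
    (\int[lebesgue_tuple p]_(u in A) (logw u)%:E < +oo)%E].

Let mlog (A : set (Rtuple R p)) : A `<=` open_corner rho ->
  measurable_fun A (fun u => (logw u)%:E).
Proof.
move=> sA; apply/measurable_EFinP.
exact: (measurable_funS (measurable_open_corner rho) sA (measurable_logw (rho := rho))).
Qed.

Lemma finite_log_measure0 : finite_log_measure set0.
Proof. by split => //; rewrite integral_set0. Qed.

Lemma finite_log_measureU A B : finite_log_measure A -> finite_log_measure B ->
  finite_log_measure (A `|` B).
Proof.
move=> [mA sA iA] [mB sB iB]; split; first exact: measurableU.
  by move=> u [/sA|/sB].
have sBA : B `\` A `<=` open_corner rho by move=> u [/sB].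
have mBA : measurable (B `\` A) by exact: measurableD.
have -> : A `|` B = A `|` (B `\` A).
  apply/seteqP; split => u; last by move=> [?|[? _]]; [left|right].
  by have [|] := pselect (A u); [left|move=> nA [|]; [left|right]].
rewrite ge0_integral_setU//.
- apply: lte_add_pinfty => //; apply: le_lt_trans iB.
  apply: ge0_subset_integral => //; first exact: mlog.
  by move=> u /sB uo; rewrite lee_fin (logw_ge0 uo).
- by apply: mlog => u [/sA|/sBA].
- by move=> u [/sA|/sBA] uo; rewrite lee_fin (logw_ge0 uo).
- by rewrite disj_set2E setDIK.
Qed.

Lemma finite_log_measure_bigU (A : 'I_p -> set (Rtuple R p)) :
  (forall j, finite_log_measure (A j)) ->
  finite_log_measure (\big[setU/set0]_(j < p) A j).
Proof.
move=> hA; elim/big_ind : _ => //; first exact: finite_log_measure0.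
exact: finite_log_measureU.
Qed.

Lemma asymptotically_finite_of_finite (U : set (Rtuple R p)) (rho' : R) :
  0 < rho -> rho <= rho' -> rho' < 1 -> finite_log_measure U ->
  asymptotically_finite_log_measure
    ((@unit_cube R p `&` ~` open_corner rho') `|` U).
Proof.
move=> rho0 rr' r'1 [mU sU iU].
have mcube : measurable (@unit_cube R p).
  rewrite (_ : @unit_cube R p = open_corner 0)//; exact: measurable_open_corner.
have mC : measurable (open_corner rho' : set (Rtuple R p)) by exact: measurable_open_corner.
have mE : measurable ((@unit_cube R p `&` ~` open_corner rho') `|` U).
  by apply: measurableU => //; apply: measurableI => //; exact: measurableC.
pose r0 : Rtuple R p := [tuple rho' | i < p].
have r'0 : 0 <= rho' by rewrite (le_trans (ltW rho0)).
split.
- move=> u [[]//|/sU uo i]; have /andP[h ->] := uo i.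
  by rewrite (le_trans (ltW rho0) h).
- by apply: sub_caratheodory; apply: sub_sigma_algebra; exact: mE.
- exists r0; first by move=> i; rewrite tnth_mktuple r'0.
  have cornerE : corner r0 = open_corner rho'.
    apply/seteqP; split=> u /=.
      by move=> [uc h] i; have := h i; rewrite tnth_mktuple => ->; have /andP[_ ->] := uc i.
    move=> h; split=> i; have /andP[h1 h2] := h i; last by rewrite tnth_mktuple.
    by rewrite h2 (le_trans r'0 h1).
  have sub : ((@unit_cube R p `&` ~` open_corner rho') `|` U) `&` corner r0 `<=` U.
    by rewrite cornerE => u [[[_ nc]|]].
  have mEc : measurable (((@unit_cube R p `&` ~` open_corner rho') `|` U) `&` corner r0).
    by rewrite cornerE; exact: measurableI.
  rewrite (@complete_lebesgue_integral R p _ (fun u => (logw u)%:E))//.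
  + apply: le_lt_trans iU; apply: ge0_subset_integral => //; first exact: mlog.
    by move=> u /sU uo; rewrite lee_fin (logw_ge0 uo).
  + by apply: mlog => u /sub/sU.
  + by move=> u /sub/sU uo; rewrite lee_fin (logw_ge0 uo).
Qed.

End FiniteLogMeasure.

Section Coefficients.
Variable a : multi_index p -> R[i]^o.
Hypotheses (p0 : (0 < p)%N) (hf : analytic_class a).
Let b n : R := normc (a n).

Lemma coef_ge0 n : 0 <= b n. Proof. exact: normc_ge0. Qed.

(** The zero series converges everywhere, in particular at (2, ..., 2), which lies outside the
    polydisc. *)
Lemma coef_neq0 : exists n, 0 < b n.
Proof.
apply: contrapT => h.
have a0 n : a n = 0.
  apply: ComplexField.Normc.eq0_normc; apply/eqP; rewrite eq_le normc_ge0 andbT leNgt.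
  by apply/negP => bn; apply: h; exists n.
have : (@polydisc R p) (const_mx 2).
  rewrite -hf /domain_of_convergence.
  rewrite (_ : [set z | _] = setT); first by rewrite interiorT.
  apply/seteqP; split => // z _ /=.
  rewrite esum1 ?ltry// => n _.
  by rewrite a0 mul0r (ComplexField.Normc.normc0 R).
move=> /(_ (Ordinal p0)); rewrite mxE.
have -> : normc (2 : R[i]) = 2.
  by rewrite -[2]/(1 + 1) /= addr0 expr0n/= addr0 sqrtr_sqr ger0_norm.
by rewrite ltNge ler1n.
Qed.

Lemma coef_summable r : unit_cube r -> exists M, forall N, psum b (@phi0 R p) N r <= M.
Proof.
move=> r1; pose z : 'rV[R[i]^o]_p := \row_j ((tnth r j : R)%:C)%C.
have zr j : normc (z 0 j) = tnth r j.
  rewrite mxE /= expr0n/= addr0 sqrtr_sqr ger0_norm//.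
  by have /andP[] := r1 j.
have : (@polydisc R p) z by move=> j; rewrite zr; have /andP[] := r1 j.
rewrite -hf => /interior_subset/=; set S := esum _ _ => Soo.
have S0 : (0 <= S)%E by apply: esum_ge0 => n _; rewrite lee_fin normc_ge0.
exists (fine S) => N; rewrite -lee_fin fineK ?ge0_fin_numE//.
have -> : psum b (@phi0 R p) N r = \sum_(n <- degree_seq p N) normc (a n * monomial z n).
  apply: eq_bigr => n _; rewrite /phi0 mul1r normcM_eq; congr (_ * _).
  rewrite /monomial normc_prodE; apply: eq_bigr => j _.
  by rewrite normcX zr.
rewrite -sumEFin; apply: ereal_sup_ubound => /=.
exists [set n | (degree n <= N)%N].
  by split => //; exact: finite_degree_le.
by rewrite fsbig_finite//=; exact: finite_degree_le.
Qed.

Lemma max_term_ge r n : unit_cube r -> b n * rmonomial n r <= max_term a r.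
Proof.
move=> r1; have r0 i : 0 <= (tnth r i : R) by have /andP[] := r1 i.
apply: ub_le_sup; last by exists n.
have [M hM] := coef_summable r1; exists M => _ [m _ <-].
apply: le_trans (hM (degree m)).
exact: (psum0_ge_term coef_ge0 (leqnn _) r0).
Qed.

End Coefficients.

End Assembly.

(** * From the grid to the whole polydisc *)

Section FinalEstimate.
Context {R : realType} (p : nat).
Variable a : multi_index p -> R[i]^o.
Hypotheses (p0 : (0 < p)%N) (hf : analytic_class a).
Let b n : R := normc (a n).
Let b0 : forall n, 0 <= b n := coef_ge0 a.
Let bsum : forall r, unit_cube r -> exists M, forall N, psum b (@phi0 R p) N r <= M
  := coef_summable hf.

Lemma perm_degree_seq_filter N N' : (N <= N')%N ->
  perm_eq [seq n <- degree_seq p N' | (degree n <= N)%N] (degree_seq p N).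
Proof.
move=> NN'; apply: uniq_perm; first by rewrite filter_uniq// uniq_degree_seq.
  exact: uniq_degree_seq.
move=> n; rewrite mem_filter !mem_degree_seq.
by case: leqP => //= h; rewrite (leq_trans h NN').
Qed.

Section Point.
Variables (r : Rtuple R p) (M : R).
Hypothesis rC : open_corner (1 / 2) r.
Hypothesis bM : forall n, b n * rmonomial n r <= M.
Variables (zeta : multi_index p -> R[i]) (z : 'rV[R[i]^o]_p).
Hypothesis zeta1 : forall n, normc (zeta n) <= 1.
Hypothesis zr : forall j, normc (z 0 j) <= (tnth r j : R).

Let half0 : 0 < 1 / 2 :> R. Proof. by []. Qed.

Let r1 : unit_cube r. Proof. exact: (open_corner_cube half0 rC). Qed.

Let r0 i : 0 <= (tnth r i : R). Proof. by have /andP[] := r1 i. Qed.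

Let t0 n : 0 <= b n * rmonomial n r. Proof. by rewrite mulr_ge0// rmonomial_ge0. Qed.

Let G0_0 : 0 <= mass b r.
Proof.
apply: le_trans (psum_le_mass b0 bsum r1 0).
by apply: psum_ge0 => // n; exact: phi0_ge0.
Qed.

Lemma grid_norm_le N (w : grid_index p N) :
  (forall j, normc (grid_point (R := R) w 0 j) <= (tnth r j : R)) ->
  grid_norm a w <= Num.sqrt (M * mass b r).
Proof.
move=> wr; apply: ler_wsqrtr.
apply: (@le_trans _ _ (\sum_(n <- degree_seq p N) M * (@phi0 R p n * (b n * rmonomial n r)))).
  apply: ler_sum => n _; rewrite /phi0 mul1r /grid_term normcM_eq expr2.
  have h : normc (a n) * normc (monomial (grid_point (R := R) w) n) <= b n * rmonomial n r.
    by rewrite ler_wpM2l ?normc_ge0// normc_monomial_le.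
  apply: ler_pM; rewrite ?mulr_ge0 ?normc_ge0//.
  exact: le_trans h (bM n).
rewrite -mulr_sumr ler_wpM2l//; first exact: le_trans (t0 [ffun=> 0%N]) (bM _).
exact: psum_le_mass.
Qed.

(** The three summands are the value at a grid point, the discretization error of the part of degree
    at most N, and the tail. Nothing depends on N', so the bound survives the limit. *)
Lemma partial_sum_le N N' Lam : (0 < N)%N -> (N <= N')%N -> 0 <= Lam ->
  (forall w : grid_index p N,
     normc (\sum_(n <- degree_seq p N) grid_term a w n * zeta n) <= 8 * grid_norm a w * Lam) ->
  normc (\sum_(n <- degree_seq p N') a n * zeta n * monomial z n) <=
  8 * Num.sqrt (M * mass b r) * Lam + 4 * mass b r / N%:R + (\sum_(j < p) moment1 b j r) / N%:R.
Proof.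
move=> N0 NN' Lam0 hN.
have NR : 0 < N%:R :> R by rewrite ltr0n.
have z1 j : normc (z 0 j) <= 1.
  by rewrite (le_trans (zr j))// ltW//; have /andP[] := rC j.
have m0 : (0 < N.+1 ^ 2)%N by rewrite expn_gt0.
have [w hw] := grid_pointP m0 z1.
have wr j : normc (grid_point (R := R) w 0 j) <= (tnth r j : R).
  by have [h _] := hw j; exact: le_trans (zr j).
(* The grid gives the absolute error 2/(N+1)^2; as r_j >= 1/2 on the corner, this is at most r_j
   e. *)
pose e : R := 4 / (N.+1 ^ 2)%:R.
have e0 : 0 <= e by rewrite divr_ge0.
have zwe j : normc (z 0 j - grid_point w 0 j) <= (tnth r j : R) * e.
  have [_ h] := hw j; apply: le_trans h _.
  rewrite /e mulrA ler_wpM2r ?invr_ge0//.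
  by have /andP[h _] := rC j; lra.
rewrite (bigID (fun n => (degree n <= N)%N))/=.
apply: le_trans (normcD_le _ _) _; apply: lerD; last first.
  apply: le_trans (normc_sum_le _ _ _) _.
  rewrite ler_pdivlMr//; apply: le_trans (tail_le b0 bsum r1 N N').
  rewrite ler_wpM2r ?(ltW NR)// /psum big_mkcond/=; apply: ler_sum => n _.
  rewrite ltnNge; case: ifP => /= [_|_]; last by rewrite mul0r.
  rewrite mul1r !normcM_eq ler_pM ?mulr_ge0 ?normc_ge0//.
    by rewrite ler_piMr ?normc_ge0.
  exact: normc_monomial_le.
rewrite -big_filter (perm_big _ (perm_degree_seq_filter NN')).
have -> : \sum_(n <- degree_seq p N) a n * zeta n * monomial z n =
    \sum_(n <- degree_seq p N) grid_term a w n * zeta n +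
    \sum_(n <- degree_seq p N) a n * zeta n * (monomial z n - monomial (grid_point w) n).
  by rewrite -big_split/=; apply: eq_bigr => n _; rewrite /grid_term; ring.
apply: le_trans (normcD_le _ _) _; apply: lerD.
  apply: le_trans (hN w) _; rewrite ler_wpM2r// ler_wpM2l//.
  exact: grid_norm_le.
apply: le_trans (normc_sum_le _ _ _) _.
apply: (@le_trans _ _ (\sum_(n <- degree_seq p N)
    (N%:R * e) * (@phi0 R p n * (b n * rmonomial n r)))).
  rewrite big_seq [leRHS]big_seq; apply: ler_sum => n; rewrite mem_degree_seq => nN.
  rewrite !normcM_eq /phi0 mul1r.
  have h1 : normc (a n) * normc (zeta n) <= b n by rewrite ler_piMr ?normc_ge0.
  have h2 := monomialB_le n zr wr e0 zwe.
  have h3 : rmonomial n r * ((degree n)%:R * e) <= rmonomial n r * (N%:R * e).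
    by rewrite ler_wpM2l ?rmonomial_ge0// ler_wpM2r// ler_nat.
  apply: le_trans (ler_pM _ _ h1 (le_trans h2 h3)) _; rewrite ?mulr_ge0 ?normc_ge0//.
  by rewrite [leRHS]mulrC -mulrA.
rewrite -mulr_sumr.
have Ne : N%:R * e <= 4 / N%:R.
  rewrite /e natrX -natr1 mulrCA ler_wpM2l//.
  rewrite ler_pdivrMr ?exprn_gt0 ?addr_gt0// mulrC ler_pdivlMr//.
  by nra.
apply: le_trans (ler_pM _ _ Ne (psum_le_mass b0 bsum r1 N)) _; rewrite ?mulr_ge0//.
  by apply: psum_ge0 => // n; exact: phi0_ge0.
by rewrite mulrAC.
Qed.

End Point.

(** As N + 1 >= 2, numerical factors are absorbed by powers of N + 1: each complex grid coordinate
    costs the exponent 8, and (N+1)(N+2) with the four signed parts costs 5. *)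
Lemma grid_size_le N : (0 < N)%N -> @grid_size R p N <= (N.+1)%:R ^+ (8 * p + 5).
Proof.
move=> N0; rewrite /grid_size -natrX ler_nat.
rewrite card_prod card_ffun !card_prod card_bool !card_ord.
set x := N.+1; have x2 : (2 <= x)%N by rewrite ltnS.
have h1 : (((x ^ 2).*2).+1 <= x ^ 4)%N.
  by rewrite -mul2n; nia.
have h2 : ((((x ^ 2).*2).+1 * ((x ^ 2).*2).+1) ^ p <= x ^ (8 * p))%N.
  rewrite expnM leq_exp2r //; first by rewrite (_ : 8 = 4 + 4)%N// expnD leq_mul.
rewrite expnD.
have h3 : (x * x.+1 * (2 * 2) <= x ^ 5)%N by nia.
by rewrite mulnCA leq_mul.
Qed.

End FinalEstimate.

(** * Choice of the truncation degree *)

Section FinalArithmetic.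
Context {R : realType} (p : nat).
Hypothesis p2 : (2 <= p)%N.

(** Here Q = W L^(p/2), M = mu_f(r), and S is the sum of the first moments. [C6] is fixed before Q
    and M, hence is uniform in r; only N varies with Q. *)
Lemma final_arithmetic (C B d : R) : 1 <= C -> 1 <= B -> 0 < d ->
  3 * p%:R * d <= 1 ->
  exists2 C6 : R, 1 <= C6 & forall Q M G S : R, 1 <= Q -> 0 < M -> 0 <= G ->
    G <= C * M * Q `^ (1 + 3 * p%:R * d) ->
    S <= p%:R * (C * Q ^+ 2) * G ->
    exists N, [/\ (0 < N)%N, 0 <= ln (B * @grid_size R p N) &
      8 * Num.sqrt (M * G) * ln (B * @grid_size R p N) + 4 * G / N%:R + S / N%:R <=
      C6 * M * Q `^ ((1 + 3 * p%:R * d) / 2 + d)].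
Proof.
move=> C1 B1 d0 pd1.
have P2 : 2 <= p%:R :> R by rewrite ler_nat.
set P : R := p%:R in pd1 P2 *.
(* Since G <= C M Q^2 and S <= P C^2 M Q^4, any N >= K Q^4 makes both 4G/N and S/N at most M. *)
pose K := 4 * P * C ^+ 2.
have C21 : 1 <= C ^+ 2 by rewrite exprn_ege1.
have K4 : 4 <= K by rewrite /K; nra.
pose k := (8 * p + 5)%N.
(* From N + 1 <= (K + 2) Q^4 and ln Q <= Q^d / d; thus the logarithm of the grid size is at most
   [C5] times Q^d. *)
pose C5 := ln B + k%:R * ln (K + 2) + k%:R * (4 / d).
have lB : 0 <= ln B by rewrite ln_ge0.
have lK : 0 <= ln (K + 2) by rewrite ln_ge0//; lra.
have C50 : 0 <= C5.
  by rewrite /C5 !addr_ge0// mulr_ge0// divr_ge0// ltW.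
exists (8 * C * C5 + 2).
  have : 0 <= 8 * C * C5 by rewrite !mulr_ge0//; lra.
  lra.
move=> Q M G S Q1 M0 G0 GQ SQ.
have Q0 : 0 < Q := lt_le_trans ltr01 Q1.
have Q21 : 1 <= Q ^+ 2 by rewrite exprn_ege1.
have Q41 : 1 <= Q ^+ 4 by rewrite exprn_ege1.
have KQ0 : 0 <= K * Q ^+ 4 by rewrite mulr_ge0// ?(le_trans ler01)//; lra.
pose N := (Num.truncn (K * Q ^+ 4)).+1.
have NK : K * Q ^+ 4 <= N%:R by rewrite ltW// truncnS_gt.
have KN : N%:R <= K * Q ^+ 4 + 1.
  by rewrite /N -natr1 lerD2r truncn_le.
have N0 : 0 < N%:R :> R by rewrite ltr0n.
have G2 : G <= C * M * Q ^+ 2.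
  apply: le_trans GQ _; rewrite ler_wpM2l//.
    by rewrite mulr_ge0// ?(ltW M0)//; lra.
  have e12 : 1 + 3 * P * d <= 2 by lra.
  by rewrite -powR_mulrn ?(ltW Q0)// ler_powR.
have g1 : 1 <= @grid_size R p N.
  rewrite /grid_size -[1](_ : 1%:R = 1)// ler_nat !muln_gt0/=.
  apply/card_gt0P; exists ([ffun=> (ord0, ord0)], (true, true)).
  by [].
have Bg1 : 1 <= B * @grid_size R p N by rewrite mulr_ege1.
have ePos : 1 <= Q `^ d by rewrite -(powRr0 Q) ler_powR// ltW.
have lnQ : ln Q <= Q `^ d / d.
  rewrite ler_pdivlMr// mulrC -ln_powR ltW// ln_sublinear//.
  by rewrite powR_gt0.
have lnL : ln (B * @grid_size R p N) <= C5 * Q `^ d.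
  have Qq : 0 < (K + 2) * Q ^+ 4 by rewrite mulr_gt0 ?exprn_gt0//; lra.
  have g2 : @grid_size R p N <= ((K + 2) * Q ^+ 4) ^+ k.
    apply: le_trans (grid_size_le (R := R) (ltnW p2) (ltn0Sn _)) _.
    rewrite lerXn2r ?nnegrE ?(ltW Qq)// -natr1 (le_trans (lerD KN (lexx 1)))//.
    by rewrite mulrDl -addrA lerD2l; lra.
  apply: (@le_trans _ _ (ln (B * ((K + 2) * Q ^+ 4) ^+ k))).
    rewrite ler_ln ?posrE ?mulr_gt0 ?exprn_gt0 ?(lt_le_trans ltr01 B1)//.
    - by rewrite ler_wpM2l// (le_trans ler01).
    - exact: lt_le_trans g1.
  have K20 : 0 < K + 2 by lra.
  rewrite lnM ?posrE ?exprn_gt0 ?(lt_le_trans ltr01 B1)// lnXn// lnM ?posrE ?exprn_gt0//.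
  rewrite lnXn// -[_ *+ k]mulr_natl -[ln Q *+ 4]mulr_natl /C5.
  have h1 : ln B <= ln B * Q `^ d by rewrite ler_peMr.
  have h2 : k%:R * ln (K + 2) <= k%:R * ln (K + 2) * Q `^ d.
    by rewrite ler_peMr// mulr_ge0.
  have h3 : k%:R * (4 * ln Q) <= k%:R * (4 / d) * Q `^ d.
    rewrite -!mulrA ler_wpM2l// ler_wpM2l// mulrC//.
  by rewrite mulrDr !mulrDl; lra.
exists N; split => //; first exact: ln_ge0.
pose e := (1 + 3 * P * d) / 2.
have sq : Num.sqrt (M * G) <= C * M * Q `^ e.
  have X0 : 0 <= C * M * Q `^ e.
    by rewrite !mulr_ge0 ?powR_ge0 ?(ltW M0)//; lra.
  rewrite -[leRHS]ger0_norm// -sqrtr_sqr ler_wsqrtr//.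
  rewrite !exprMn -[Q `^ e ^+ 2]powR_mulrn ?powR_ge0// -powRrM.
  have -> : e * 2 = 1 + 3 * P * d by rewrite /e; field.
  apply: le_trans (ler_wpM2l (ltW M0) GQ) _.
  set q := Q `^ _.
  have -> : M * (C * M * q) = C * (M ^+ 2 * q) by ring.
  have Mq : 0 <= M ^+ 2 * q := mulr_ge0 (sqr_ge0 M) (powR_ge0 _ _).
  rewrite -[leRHS]mulrA ler_wpM2r//.
  by rewrite expr2 ler_peMr//; lra.
have t1 : 4 * G / N%:R <= M.
  rewrite ler_pdivrMr//; apply: (@le_trans _ _ (4 * (C * M * Q ^+ 2))).
    by rewrite ler_wpM2l.
  apply: (@le_trans _ _ (M * (K * Q ^+ 4))); last by rewrite ler_wpM2l// ltW.
  have -> : 4 * (C * M * Q ^+ 2) = M * (4 * C * Q ^+ 2) by ring.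
  rewrite ler_wpM2l ?(ltW M0)// ler_pM ?sqr_ge0//.
  - by rewrite mulr_ge0//; lra.
  - by rewrite /K; nra.
  - by rewrite ler_weXn2l.
have t2 : S / N%:R <= M.
  rewrite ler_pdivrMr//; apply: le_trans SQ _.
  have PC0 : 0 <= P * (C * Q ^+ 2).
    by rewrite !mulr_ge0 ?sqr_ge0//; lra.
  apply: le_trans (ler_wpM2l PC0 G2) _.
  apply: (@le_trans _ _ (M * (K * Q ^+ 4))); last by rewrite ler_wpM2l// ltW.
  have -> : P * (C * Q ^+ 2) * (C * M * Q ^+ 2) = M * (P * C ^+ 2 * Q ^+ 4) by ring.
  rewrite ler_wpM2l ?(ltW M0)// ler_wpM2r//; first by rewrite (le_trans ler01).
  by rewrite /K; nra.
have t3 : 8 * Num.sqrt (M * G) * ln (B * @grid_size R p N) <=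
    8 * C * C5 * M * Q `^ (e + d).
  rewrite powRD; last by rewrite (gt_eqF Q0) implybT.
  apply: (@le_trans _ _ (8 * (C * M * Q `^ e) * (C5 * Q `^ d))).
    have sq0 : 0 <= 8 * Num.sqrt (M * G) by rewrite mulr_ge0// sqrtr_ge0.
    have sq8 : 8 * Num.sqrt (M * G) <= 8 * (C * M * Q `^ e) by rewrite ler_wpM2l.
    exact: ler_pM sq0 (ln_ge0 Bg1) sq8 lnL.
  rewrite le_eqVlt; apply/orP; left; apply/eqP; ring.
have t4 : M <= M * Q `^ (e + d).
  rewrite ler_peMr ?(ltW M0)// -(powRr0 Q) ler_powR//.
  have Pd0 : 0 <= 3 * P * d by rewrite !mulr_ge0// ?(ltW d0)//; lra.
  by rewrite /e; lra.
rewrite -/e mulrDl mulrDl; lra.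
Qed.

(** Brings the target to a power of the same Q = W L^(p/2) in which the estimates are expressed. *)
Lemma normalized_rhsE (r : Rtuple R p) (L delta : R) : 0 <= L ->
  (forall j, (tnth r j : R) < 1) ->
  (\prod_(j < p) (Num.sqrt (1 - (tnth r j : R)))^-1 * L `^ (p%:R / 4)) `^ (1 + delta) =
  (logw r * L `^ (p%:R / 2)) `^ ((1 + delta) / 2).
Proof.
move=> L0 r1.
have t0 j : 0 <= 1 - (tnth r j : R) by rewrite subr_ge0 ltW.
have -> : \prod_(j < p) (Num.sqrt (1 - (tnth r j : R)))^-1 = logw r `^ (2^-1).
  rewrite /logw powR_prod; last by move=> j _; rewrite invr_ge0.
  by apply: eq_bigr => j _; rewrite powR12_sqrt ?invr_ge0// sqrtrV.
have W0 : 0 <= logw r by apply: prodr_ge0 => j _; rewrite invr_ge0.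
have -> : L `^ (p%:R / 4) = (L `^ (p%:R / 2)) `^ (2^-1).
  by rewrite -powRrM; congr (_ `^ _); field.
by rewrite -powRM ?powR_ge0// -powRrM; congr (_ `^ _); field.
Qed.

End FinalArithmetic.

Theorem theorem2p3 (R : realType) (p : nat) (hp : (2 <= p)%N)
  (a : multi_index p -> R[i]^o) (hf : analytic_class a)
  (Z : multi_index p -> @lebesgue_line R -> R[i])
  (hZ : complex_MS Z) (hZ1 : bounded_by_one Z)
  (delta : R) (hdelta : 0 < delta) :
  {ae @completed_lebesgue_measure R, forall t,
     unit_interval t ->
     exists2 E : set (Rtuple R p),
       asymptotically_finite_log_measure E &
       forall r : Rtuple R p, unit_cube r -> ~ E r ->
         (max_modulus (multi_series (fun n => a n * Z n t)%R) r <=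
          (max_term a r *
             (\prod_(j < p) (Num.sqrt (1 - (tnth r j : R)))^-1 *
              ln (max_term a r * \prod_(j < p) (1 - (tnth r j : R))^-1)
                `^ (p%:R / 4)) `^ (1 + delta))%:E)%E}.
Proof.
have p0 : (0 < p)%N by exact: ltnW.
have [n0 bn0] := coef_neq0 p0 hf.
pose b n : R := normc (a n).
have b0 : forall n, 0 <= b n := coef_ge0 a.
have bsum := coef_summable hf.
have half0 : 0 < 1 / 2 :> R by [].
have half1 : 1 / 2 < 1 :> R by lra.
have P2 : 2 <= p%:R :> R by rewrite ler_nat.
have P0 : 0 < p%:R :> R by rewrite ltr0n.
(* As p >= 2, the second entry gives 3pd/2 + d <= delta/4, which leaves Q^(delta/4) to absorb the
   constant [C6]. *)
pose d := Num.min (3 * p%:R)^-1 (delta / (8 * p%:R)).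
have d0 : 0 < d by rewrite lt_min invr_gt0 mulr_gt0//= divr_gt0// mulr_gt0.
have pd1 : 3 * p%:R * d <= 1.
  by rewrite mulrC -ler_pdivlMr ?mulr_gt0// div1r ge_min lexx.
have pd2 : 2 * p%:R * d <= delta / 4.
  have : d <= delta / (8 * p%:R) by rewrite ge_min lexx orbT.
  rewrite ler_pdivlMr ?mulr_gt0// => h.
  by lra.
have Pd0 : 0 < p%:R * d by rewrite mulr_gt0.
have dP : d <= p%:R * d by rewrite ler_peMl ?(ltW d0)//; lra.
have d1 : d <= 1 by lra.
have [C C1 growth] := growth_estimate b0 bsum bn0 half0 p0.
pose U := \big[setU/set0]_(j < p)
  (mean_set b n0 (1 / 2) d j `|` variance_set b (1 / 2) d j).
have UF : finite_log_measure (1 / 2) U.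
  apply: finite_log_measure_bigU => j; apply: finite_log_measureU.
    have [m1 m2] := mean_set_log_measure b0 bsum bn0 half0 half1 d0 j.
    by split => // u [].
  have [m1 m2] := variance_set_log_measure b0 bsum bn0 half0 half1 d0 j.
  by split => // u [].
pose c := low_term b n0 (1 / 2).
have c0 : 0 < c by exact: low_term_gt0.
have rb := random_polynomial_bound a hZ hZ1.
apply: filterS2 rb hZ1 => t hB hZt Dt.
have [B B1 {}hB] := hB Dt; have {}hZt := hZt Dt.
have [C6 C61 hC6] := final_arithmetic hp C1 B1 d0 pd1.
(* On the corner at 1 - 1/A one has W >= A. The three summands give in turn [C6] <= Q^(delta/4), a
   corner inside the one at 1/2, and M W >= e, that is L >= 1. A depends on t through [C6]. *)
pose A := C6 `^ (4 / delta) + 2 + expR 1 / c.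
have A2 : 2 <= A.
  have h1 : 0 <= C6 `^ (4 / delta) by exact: powR_ge0.
  have h2 : 0 <= expR 1 / c by rewrite divr_ge0 ?expR_ge0// ltW.
  by rewrite /A; lra.
have A0 : 0 < A by lra.
pose rho' := 1 - A^-1.
have iA : A^-1 <= 1 / 2 by rewrite invf_ple ?posrE//; lra.
have iA0 : 0 < A^-1 by rewrite invr_gt0.
have hr1 : 1 / 2 <= rho' by rewrite /rho'; lra.
have hr2 : rho' < 1 by rewrite /rho'; lra.
have hr0 : 0 < rho' by lra.
exists ((@unit_cube R p `&` ~` open_corner rho') `|` U).
  exact: (asymptotically_finite_of_finite half0 hr1 hr2 UF).
move=> r rU rE.
have ro' : open_corner rho' r.
  by apply: contrapT => h; apply: rE; left.
have nU : ~ U r by move=> h; apply: rE; right.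
have ro : open_corner (1 / 2) r.
  by move=> i; have /andP[h ->] := ro' i; rewrite (le_trans hr1).
have rmean j : ~ mean_set b n0 (1 / 2) d j r.
  by move=> h; apply: nU; rewrite /U (bigD1 j)//=; left; left.
have rvar j : ~ variance_set b (1 / 2) d j r.
  by move=> h; apply: nU; rewrite /U (bigD1 j)//=; left; right.
set M := max_term a r.
have bM n : b n * rmonomial n r <= M by exact: max_term_ge.
have cM : c <= M.
  apply: le_trans (bM n0); rewrite /c /low_term ler_wpM2l//.
  by apply: rmonomial_ge => //; exact: open_corner_closed.
have M0 : 0 < M := lt_le_trans c0 cM.
rewrite -/(logw r).
set W := logw r.
have W1 : 1 <= W by exact: (logw_ge1 half0 ro).
have AW : A <= W.
  pose j0 := Ordinal p0.
  apply: le_trans (inv_sub_le_logw hr0 j0 ro').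
  rewrite -[leLHS]invrK lef_pV2 ?posrE ?(open_corner_gt0 _ ro')//.
  by have /andP[h _] := ro' j0; rewrite /rho' in h; lra.
set L := ln (M * W).
have L1 : 1 <= L.
  rewrite /L -[leLHS]expRK ler_ln ?posrE ?expR_gt0 ?(mulr_gt0 M0 (lt_le_trans ltr01 W1))//.
  have : expR 1 / c <= W.
    by apply: le_trans AW; rewrite /A lerDr addr_ge0// powR_ge0.
  rewrite ler_pdivrMr// => h; apply: le_trans h _.
  by rewrite mulrC ler_wpM2r// (le_trans ler01).
have [hG hm] := growth d r M d0 d1 ro rmean rvar bM L1.
rewrite -/W -/L in hG hm.
pose Q := W * L `^ (p%:R / 2).
(* From p >= 2 and L >= 1; hence W L <= Q, which expresses the bound on the means through Q. *)
have Lp : L <= L `^ (p%:R / 2).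
  by rewrite -[leLHS]powRr1 ?(le_trans ler01)// ler_powR//; lra.
have Lp1 : 1 <= L `^ (p%:R / 2) := le_trans L1 Lp.
have W0 : 0 <= W := le_trans ler01 W1.
have L0 : 0 <= L := le_trans ler01 L1.
have WQ : W <= Q by rewrite /Q ler_peMr.
have Q1 : 1 <= Q := le_trans W1 WQ.
have Q0 : 0 <= Q := le_trans ler01 Q1.
have C0 : 0 <= C := le_trans ler01 C1.
have G0p : 0 <= mass b r by rewrite (le_trans (ltW c0))//; exact: low_term_le_mass.
have hGQ : mass b r <= C * M * Q `^ (1 + 3 * p%:R * d).
  apply: le_trans hG _; rewrite ler_wpM2l ?mulr_ge0 ?(ltW M0)//.
  rewrite /Q powRM ?powR_ge0//; apply: ler_pM; rewrite ?powR_ge0//.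
    by rewrite ler_powR//; lra.
  by rewrite -powRrM ler_powR// ler_wpM2l//; lra.
have hS : \sum_(j < p) moment1 b j r <= p%:R * (C * Q ^+ 2) * mass b r.
  have -> : p%:R * (C * Q ^+ 2) * mass b r = \sum_(j < p) (C * Q ^+ 2) * mass b r.
    by rewrite sumr_const card_ord -[RHS]mulr_natl !mulrA.
  apply: ler_sum => j _.
  have Gp : 0 < mass b r by rewrite (lt_le_trans c0)//; exact: low_term_le_mass.
  rewrite -ler_pdivrMr//; apply: le_trans (hm j) _.
  rewrite ler_wpM2l// lerXn2r ?nnegrE ?(mulr_ge0 W0 L0)//.
  by rewrite /Q ler_wpM2l.
have [N [N0 Lam0 hN]] := hC6 Q M _ _ Q1 M0 G0p hGQ hS.
rewrite normalized_rhsE//; last by move=> j; have /andP[] := rU j.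
rewrite -/W -/Q.
have CQ : C6 * M * Q `^ ((1 + 3 * p%:R * d) / 2 + d) <= M * Q `^ ((1 + delta) / 2).
  have h1 : C6 <= Q `^ (delta / 4).
    have -> : C6 = (C6 `^ (4 / delta)) `^ (delta / 4).
      rewrite -powRrM (_ : 4 / delta * (delta / 4) = 1).
        by rewrite powRr1// (le_trans ler01).
      by field; rewrite gt_eqF.
    apply: ge0_ler_powR; rewrite ?nnegrE ?powR_ge0//.
      by rewrite divr_ge0// ltW.
    apply: le_trans WQ; apply: le_trans AW.
    by rewrite /A -addrA lerDl addr_ge0// divr_ge0 ?expR_ge0// ltW.
  rewrite [C6 * M]mulrC -[leLHS]mulrA ler_wpM2l ?(ltW M0)//.
  apply: le_trans (ler_wpM2r (powR_ge0 _ _) h1) _.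
  rewrite -powRD; last by rewrite (gt_eqF (lt_le_trans ltr01 Q1)) implybT.
  by rewrite ler_powR//; nra.
apply: ge_ereal_sup => _ [z zr <-]; rewrite lee_fin.
apply: le_trans CQ; apply: le_trans hN.
have S0 : 0 <= \sum_(j < p) moment1 b j r.
  apply: sumr_ge0 => j _.
  rewrite -[moment1 b j r](divfK (x := mass b r)); last first.
    by rewrite gt_eqF// (lt_le_trans c0)//; exact: low_term_le_mass.
  by rewrite mulr_ge0//; exact: (smean_ge0 b0 bsum bn0 half0 j ro).
apply: (@normc_lim_le R _ _ N).
  by rewrite !addr_ge0 ?divr_ge0 ?mulr_ge0 ?sqrtr_ge0.
move=> N' NN'.
rewrite fsbig_finite/=; last exact: finite_degree_le.
apply: (partial_sum_le hf ro bM hZt zr N0 NN' Lam0) => w.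
exact: hB.
Qed.
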